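(* Let $\mathcal{G}=(V,v_i,\Delta)$ with $V=V_{\mathsf{Reach}}\uplus V_{\mathsf{Safe}}\uplus V_{\mathit{Eff}}$ be a reachability game, let $\Pi\in\{\mathsf{Reach},\mathsf{Safe}\}$, let $\sigma$ be an MD-strategy for $\Pi$, and let $C\subseteq V$ be disjoint from $V_{\mathit{Eff}}$. Then it can be checked in polynomial time whether $C$ is a $d_{\mathit{pref}}^H$-counterfactual cause for the fact that $\Pi$ loses using $\sigma$ in $\mathcal{G}$.
   Context: A reachability game $\mathcal{G}=(V,v_i,\Delta)$ has finite vertex set $V=V_{\mathsf{Reach}}\uplus V_{\mathsf{Safe}}\uplus V_{\mathit{Eff}}$ (vertices of player Reach, of player Safe, and target vertices, which are terminal), initial vertex $v_i\notin V_{\mathit{Eff}}$, and edges $\Delta\subseteq V\times V$. A play is either a finite path from $v_i$ along edges ending in a target vertex, or an infinite such path. An MD-strategy for player $\Pi$ maps each vertex $v\in V_\Pi$ to an outgoing edge $\sigma(v)$; a play is a $\sigma$-play if it follows $\sigma$ at every vertex of $V_\Pi$. $\sigma$ is winning for Reach if all $\sigma$-plays from $v_i$ end in a target vertex, and winning for Safe if no $\sigma$-play reaches a target vertex; a player loses on a play if the play is not won by that player in this sense. $\tau$ avoids $C$ if no $\tau$-play visits $C$. For a distance function $D$ on MD-strategies, $C$ is a $D$-counterfactual cause for the fact that $\Pi$ loses using $\sigma$ if (1) there are $\sigma$-plays reaching $C$ on which $\Pi$ loses, (2) some MD-strategy for $\Pi$ avoids $C$, and (3) every MD-strategy $\tau$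 for $\Pi$ avoiding $C$ with minimal $D(\sigma,\tau)$ among MD-strategies avoiding $C$ is winning for $\Pi$. The prefix metric on plays is $d_{\mathit{pref}}(\pi,\rho)=2^{-m}$, $m$ the length of the longest common prefix of $\pi$ and $\rho$ as vertex sequences, and $d_{\mathit{pref}}^H(\sigma,\tau)=\max\{\sup_{\sigma\text{-plays }\pi}\inf_{\tau\text{-plays }\rho}d_{\mathit{pref}}(\pi,\rho),\ \sup_{\tau\text{-plays }\rho}\inf_{\sigma\text{-plays }\pi}d_{\mathit{pref}}(\pi,\rho)\}$ (plays starting at $v_i$).
   Formalization: Every non-target vertex (also the opponent's) is assumed to have an outgoing edge, since otherwise a strategy may have no plays and the distance is undefined; and the prefix metric is taken to be 0 on equal finite plays, where the formula 2^{-m} would not give a metric. *)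

(* Defs.v *)
(* MathComp + MathComp-Analysis. *)
From HB Require Import structures.
From mathcomp Require Import all_boot all_order all_algebra.
From mathcomp Require Import boolp classical_sets reals constructive_ereal ereal.

Set Implicit Arguments.
Unset Strict Implicit.
Unset Printing Implicit Defensive.

Import Order.TTheory GRing.Theory Num.Theory.

(** * Reachability games *)

Inductive player := Reach | Safe.

Definition bool_of_player (P : player) : bool := if P is Reach then true else false.
Definition player_of_bool (b : bool) : player := if b then Reach else Safe.
Lemma bool_of_playerK : cancel bool_of_player player_of_bool.
Proof. by case. Qed.
HB.instance Definition _ := Equality.copy player (can_type bool_of_playerK).

(* The partition of the vertices is given by [owner]: [Some P] for the vertices
   of player P and [None] for the target vertices.  A play is a path that ends in
   a target or is infinite, so the dead ends of the graph are exactly the target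
   vertices: targets are terminal, and every other vertex has an outgoing edge. *)
Record game := Game {
  vertex :> finType;
  init : vertex;
  owner : vertex -> option player;
  edge : rel vertex;
  init_nontarget : owner init <> None;
  target_terminal : forall v w, owner v = None -> ~~ edge v w;
  nontarget_succ : forall v, owner v <> None -> exists w, edge v w
}.

Definition controls (G : game) (P : player) (v : G) : bool := owner v == Some P.

Definition targets (G : game) : {set G} := [set v | owner v == None].

(* An MD-strategy is represented by the successor it selects; its values outside
   the vertices of P are never used. *)
Record strategy (G : game) (P : player) := Strategy {
  choice :> {ffun G -> G};
  choice_edge : forall v, controls P v -> edge v (choice v)
}.

(** * Plays *)

Inductive vseq (V : Type) := Fin of seq V | Inf of (nat -> V).

Definition vertex_at (V : Type) (p : vseq V) (i : nat) : option V :=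
  match p with
  | Fin s => onth s i
  | Inf f => Some (f i)
  end.

Definition is_play (G : game) (p : vseq G) : Prop :=
  match p with
  | Fin [::] => False
  | Fin (v :: s) => [/\ v = init G, path (@edge G) v s & last v s \in targets G]
  | Inf f => f 0 = init G /\ forall i, edge (f i) (f i.+1)
  end.

Definition follows (G : game) (P : player) (sigma : strategy G P) (p : vseq G) : Prop :=
  forall i v w, vertex_at p i = Some v -> vertex_at p i.+1 = Some w ->
    controls P v -> w = sigma v.

Definition plays (G : game) (P : player) (sigma : strategy G P) : set (vseq G) :=
  fun p => is_play p /\ follows sigma p.

Definition visits (G : game) (p : vseq G) (A : {set G}) : Prop :=
  exists i v, vertex_at p i = Some v /\ v \in A.

Definition ends_in (G : game) (p : vseq G) (A : {set G}) : Prop :=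
  exists s v, p = Fin (rcons s v) /\ v \in A.

Definition wins (G : game) (P : player) (p : vseq G) : Prop :=
  match P with
  | Reach => ends_in p (targets G)
  | Safe => ~ visits p (targets G)
  end.

Definition winning (G : game) (P : player) (sigma : strategy G P) : Prop :=
  forall p, plays sigma p -> wins P p.

Definition avoids (G : game) (P : player) (tau : strategy G P) (C : {set G}) : Prop :=
  forall p, plays tau p -> ~ visits p C.

(** * Prefix metric and its Hausdorff lifting *)

Definition common_prefix (V : Type) (p q : vseq V) (m : nat) : Prop :=
  forall i, i < m -> vertex_at p i <> None /\ vertex_at p i = vertex_at q i.

Definition is_lcp_length (V : Type) (p q : vseq V) : set nat :=
  fun m => common_prefix p q m /\ ~ common_prefix p q m.+1.

(* Being a metric, it vanishes on equal plays, finite ones included; distinct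
   sequences do have a longest common prefix, so the default value of [xget]
   is not used. *)
Definition d_pref (R : realType) (V : Type) (p q : vseq V) : R :=
  if `[< vertex_at p =1 vertex_at q >] then 0%R
  else (2 ^- xget 0%N (is_lcp_length p q))%R.

Definition d_pref_H (R : realType) (G : game) (P : player)
    (sigma tau : strategy G P) : \bar R :=
  maxe
    (ereal_sup [set ereal_inf [set (d_pref R p q)%:E | q in plays tau]
               | p in plays sigma]%classic)
    (ereal_sup [set ereal_inf [set (d_pref R p q)%:E | p in plays sigma]
               | q in plays tau]%classic).

(** * Counterfactual causes *)

Definition minimal_avoiding (R : realType) (G : game) (P : player)
    (D : strategy G P -> strategy G P -> \bar R)
    (sigma : strategy G P) (C : {set G}) (tau : strategy G P) : Prop :=
  avoids tau C /\
  forall tau' : strategy G P, avoids tau' C -> (D sigma tau <= D sigma tau')%E.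

Definition counterfactual_cause (R : realType) (G : game) (P : player)
    (D : strategy G P -> strategy G P -> \bar R)
    (sigma : strategy G P) (C : {set G}) : Prop :=
  [/\ exists p, [/\ plays sigma p, visits p C & ~ wins P p],
      exists tau : strategy G P, avoids tau C
    & forall tau : strategy G P, minimal_avoiding D sigma C tau -> winning tau].

(** * Polynomial time: deterministic multitape Turing machines *)

(* Tape symbols: [None] is the blank, [Some (inl b)] an input bit, and
   [Some (inr a)] an auxiliary symbol. *)
Definition tape_symbol (aux : finType) : Type := option (bool + aux).

Inductive move := MoveLeft | Stay | MoveRight.

(* The machine has [extra_tapes.+1] tapes, and the input is on tape [ord0].  A
   state q with [verdict q = Some b] is halting, with answer b. *)
Record machine := Machine {
  extra_tapes : nat;
  aux : finType;
  state : finType;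
  start : state;
  verdict : state -> option bool;
  delta : state -> ('I_extra_tapes.+1 -> tape_symbol aux) ->
    state * ('I_extra_tapes.+1 -> tape_symbol aux * move)
}.

(* A two-way infinite tape: the scanned cell and the cells on either side of it,
   nearest first, all further cells being blank. *)
Record tape (aux : finType) := Tape {
  to_left : seq (tape_symbol aux);
  scanned : tape_symbol aux;
  to_right : seq (tape_symbol aux)
}.

Definition update_tape (aux : finType) (t : tape aux)
    (wm : tape_symbol aux * move) : tape aux :=
  let: Tape l _ r := t in
  let: (a, m) := wm in
  match m with
  | MoveLeft => Tape (behead l) (head None l) (a :: r)
  | Stay => Tape l a r
  | MoveRight => Tape (a :: l) (head None r) (behead r)
  end.

Definition config (M : machine) : Type :=
  (state M * ('I_(extra_tapes M).+1 -> tape (aux M)))%type.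

Definition step (M : machine) (c : config M) : config M :=
  let: (q, ts) := c in
  if verdict q is Some _ then c else
  let: (q', act) := delta q (fun i => scanned (ts i)) in
  (q', fun i => update_tape (ts i) (act i)).

Definition input_tape (aux : finType) (w : seq bool) : tape aux :=
  let s : seq (tape_symbol aux) := [seq Some (inl b) | b <- w] in
  Tape [::] (head None s) (behead s).

Definition start_config (M : machine) (w : seq bool) : config M :=
  (start M, fun i => if i == ord0 then input_tape (aux M) w else Tape [::] None [::]).

(* Halting configurations are fixed by [step], so this says that M halts on w
   after at most t steps with answer b. *)
Definition answers_within (M : machine) (w : seq bool) (t : nat) (b : bool) : Prop :=
  verdict (iter t (@step M) (start_config M w)).1 = Some b.

Definition decidable_in_ptime (I : Type) (encode : I -> seq bool)
    (Q : I -> Prop) : Prop :=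
  exists (M : machine) (c k : nat), forall x : I,
    exists2 b : bool, answers_within M (encode x) (c * size (encode x) ^ k + c) b
                    & (b <-> Q x).

(** * Instances of the decision problem *)

Record instance := Instance {
  the_game : game;
  the_player : player;
  the_strategy : strategy the_game the_player;
  the_set : {set the_game};
  the_set_disjoint : [disjoint the_set & targets the_game]
}.

(* The number of vertices in unary, one bit for the player, and one block per
   vertex v, in the order of [enum]: its owner, whether it is initial, whether it
   is in C, its row of the adjacency matrix of the edge relation, and its row of
   the 0-1 matrix of the strategy (zero if v is not controlled by the player). *)
Definition encode_vertex (x : instance) (v : the_game x) : seq bool :=
  [:: controls Reach v; controls Safe v; v == init (the_game x); v \in the_set x]
  ++ [seq edge v w | w <- enum (the_game x)]
  ++ [seq controls (the_player x) v && (the_strategy x v == w)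
     | w <- enum (the_game x)].

Definition encode_instance (x : instance) : seq bool :=
  nseq #|the_game x| true ++ [:: false; the_player x == Reach]
  ++ flatten [seq encode_vertex v | v <- enum (the_game x)].

(* [the_player x] loses using [the_strategy x], and [the_set x] is a cause. *)
Definition is_d_pref_H_cause (R : realType) (x : instance) : Prop :=
  counterfactual_cause (@d_pref_H R (the_game x) (the_player x))
    (the_strategy x) (the_set x).

(* Main.v *)
(* Let the k-th layer set consist of the vertices reached from the initial vertex
   by fewer than k edges under sigma.  The Hausdorff prefix distance from sigma to
   tau is at most 2^-(k+1) iff tau agrees with sigma on this set.  Hence the closest strategies avoiding C are the
   avoiding ones that agree with sigma on the largest layer set for which there is
   one, and with the choices on a set of vertices fixed, avoiding C amounts to
   staying out of the opponent's attractor of C.  So C is a cause iff condition (1)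
   holds, the initial vertex is not in the attractor for the empty layer set, and
   no losing walk of the game restricted to the best layer set stays outside its
   attractor: all this is expressed by polynomially many steps of monotone
   operators on sets of vertices.

   For the time bound, a graph automaton has a finite label on each vertex, updated
   synchronously from the labels of the neighbours, and a finite global state,
   updated from the set of labels present.  A three-tape machine simulates each
   round in linear time, and the decision procedure is a graph automaton with
   quadratically many rounds. *)
Require Import Defs.
From HB Require Import structures.
From mathcomp Require Import boolp classical_sets reals constructive_ereal ereal.
From mathcomp Require Import all_boot all_order all_algebra.
From mathcomp Require Import zify.

Set Implicit Arguments.
Unset Strict Implicit.
Unset Printing Implicit Defensive.

Import Order.TTheory GRing.Theory Num.Theory.

(** * Graphs and least fixpoints *)

(** Condition (3) quantifies over exponentially many strategies. It becomes tractable because a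
    single MD-strategy can follow a given losing walk outside the attractor and still avoid [C]
    everywhere else. For this the walk must prescribe at most one edge per vertex: for Safe it is
    shortened to a simple path, for Reach it is the orbit of a successor function. The search for
    the best level is short: the layer sets are stationary after at most [#|G|] steps, and condition
    (1) gives a walk of [sigma] into [C], so agreement with [sigma] on everything it reaches is
    incompatible with avoiding [C]. The fixpoint form is dictated by the machine model: one
    application of each operator asks only which labels occur among the neighbours of a vertex, and
    stationarity is an existential question about the set of all labels. *)

Section Graphs.
Variable T : finType.
Implicit Types (e : rel T) (B X Y : {set T}) (f : {set T} -> {set T}).

Definition infinite_walk e v : Prop :=
  exists2 h : nat -> T, h 0 = v & forall i, e (h i) (h i.+1).

Definition pre e X : {set T} := [set v | [exists w, e v w && (w \in X)]].
Definition wpre e X : {set T} := [set v | [forall w, e v w ==> (w \in X)]].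
Definition post e X : {set T} := [set v | [exists w, e w v && (w \in X)]].

Lemma pre_mono e : {homo pre e : X Y / X \subset Y}.
Proof.
move=> X Y XY; apply/fintype.subsetP => v; rewrite !inE => /existsP[w /andP[evw Xw]].
by apply/existsP; exists w; rewrite evw (fintype.subsetP XY).
Qed.

Lemma wpre_mono e : {homo wpre e : X Y / X \subset Y}.
Proof.
move=> X Y XY; apply/fintype.subsetP => v; rewrite !inE => /forallP eX.
by apply/forallP=> w; apply/implyP=> /(implyP (eX w)); apply: (fintype.subsetP XY).
Qed.

Lemma post_mono e : {homo post e : X Y / X \subset Y}.
Proof.
move=> X Y XY; apply/fintype.subsetP => v; rewrite !inE => /existsP[w /andP[evw Xw]].
by apply/existsP; exists w; rewrite evw (fintype.subsetP XY).
Qed.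

Lemma setU_mono B f : {homo f : X Y / X \subset Y} ->
  {homo (fun X => B :|: f X) : X Y / X \subset Y}.
Proof. by move=> f_mono X Y XY; apply: finset.setUS; apply: f_mono. Qed.

(** Park induction: [fixset f] unfolds to a finite iterate of [f] from the empty set. *)
Lemma fixset_ind f Y : (forall X, X \subset Y -> f X \subset Y) -> fixset f \subset Y.
Proof.
move=> fY; suff fk k : iter k f (@finset.set0 T) \subset Y by apply: fk.
by elim: k => [|k IH] /=; rewrite ?finset.sub0set ?fY.
Qed.

Lemma fixset_pre e B v :
  reflect (exists2 u, u \in B & connect e v u) (v \in fixset (fun X => B :|: pre e X)).
Proof.
have mono := setU_mono B (@pre_mono e).
apply: (iffP idP).
  suff /fintype.subsetP sub : fixset (fun X => B :|: pre e X) \subset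
      [set v | [exists u, (u \in B) && connect e v u]].
    by move/sub; rewrite inE => /existsP[u /andP[? ?]]; exists u.
  apply: fixset_ind => X /fintype.subsetP XY; apply/fintype.subsetP => w.
  rewrite !inE => /orP[Bw|/existsP[u /andP[ewu /XY]]].
    by apply/existsP; exists w; rewrite Bw connect0.
  rewrite inE => /existsP[t /andP[Bt ut]]; apply/existsP; exists t.
  by rewrite Bt (connect_trans (connect1 ewu)).
case=> u Bu /connectP[p]; elim: p v => [|w p IH] v /= => [_ <-|/andP[evw ep] ul].
  by rewrite -(fixsetK mono) inE Bu.
rewrite -(fixsetK mono) !inE; apply/orP; right; apply/existsP; exists w.
by rewrite evw IH.
Qed.

(** A vertex outside the least fixpoint has a successor outside it, and choosing such successors
    builds the walk. Conversely, the vertices without infinite walk form a set closed under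
    [wpre]. *)
Lemma fixset_wpre e v : v \in ~: fixset (wpre e) <-> infinite_walk e v.
Proof.
rewrite inE; split.
  have step u : exists w, u \notin fixset (wpre e) -> e u w /\ w \notin fixset (wpre e).
    have [|uF] := boolP (u \in fixset (wpre e)); first by exists u.
    move: (uF); rewrite -{1}(fixsetK (@wpre_mono e)) inE negb_forall => /existsP[w].
    by rewrite negb_imply => /andP[ew wF]; exists w.
  have [nxt nxtP] := boolp.choice step => vF.
  have inv i : iter i nxt v \notin fixset (wpre e).
    by elim: i => //= i /nxtP[].
  by exists (fun i => iter i nxt v) => // i; have [] := nxtP _ (inv i).
case=> h <- eh; suff /fintype.subsetP sub :
    fixset (wpre e) \subset [set v | `[< ~ infinite_walk e v >]].
  by apply/negP => /sub; rewrite inE => /asboolP; apply; exists h.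
apply: fixset_ind => X /fintype.subsetP XY; apply/fintype.subsetP => u.
rewrite !inE => /forallP eX; apply/asboolP => -[g gu eg].
have eu : e u (g 1) by rewrite -gu.
have /XY := implyP (eX (g 1)) eu.
by rewrite inE => /asboolP; apply; exists (g \o succn) => // i; apply: eg.
Qed.

(** The inclusion is asked only at reachable vertices because an avoiding strategy is constrained
    only at the vertices it reaches. *)
Lemma connect_sub_reachable e e' x v :
    (forall u w, connect e x u -> e u w -> e' u w) ->
  connect e x v -> connect e' x v.
Proof.
move=> ee' /connectP[p]; elim/last_ind: p v => [|p w IH] v.
  by move=> _ ->; rewrite connect0.
rewrite rcons_path last_rcons => /andP[ep el] ->.
apply: (connect_trans (IH _ ep erefl)); apply/connect1/ee' => //.
by apply/connectP; exists p.
Qed.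

Lemma infinite_walk_sub_reachable e e' x :
    (forall u w, connect e x u -> e u w -> e' u w) ->
  infinite_walk e x -> infinite_walk e' x.
Proof.
move=> ee' [h h0 eh]; exists h => // i; apply: ee' => //.
by elim: i => [|i IH]; rewrite ?h0 ?connect0 // (connect_trans IH) // connect1.
Qed.

(** Glues a finite path and a sequence into one total function, so that finite and infinite
    continuations are handled alike. *)
Lemma path_then e x s (h : nat -> T) : path e x s -> h 0 = last x s ->
  exists f : nat -> T, [/\ forall i, i <= size s -> f i = nth x (x :: s) i,
    forall i, i < size s -> e (f i) (f i.+1) & forall i, f (size s + i) = h i].
Proof.
move=> /(pathP x) es h0.
pose f i := if i < size s then nth x (x :: s) i else h (i - size s).
have fs i : i <= size s -> f i = nth x (x :: s) i.
  rewrite leq_eqVlt /f => /predU1P[->|->] //.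
  by rewrite ltnn subnn h0 (last_nth x).
exists f; split=> // i; last by rewrite /f ltnNge leq_addr addKn.
by move=> si; rewrite !fs // 1?ltnW //; apply: es.
Qed.

End Graphs.

(** * Plays as walks *)

Section Plays.
Variables (G : game) (P : player).
Implicit Types (sigma tau : strategy G P) (C R A : {set G}) (v w : G) (p q : vseq G).

Definition sedge tau : rel G :=
  fun v w => edge v w && (controls P v ==> (w == tau v)).

Lemma edge_nontarget v w : edge v w -> v \notin targets G.
Proof. by rewrite inE; apply: contraTN => /eqP/target_terminal->. Qed.

Lemma sedge_nontarget tau v w : sedge tau v w -> v \notin targets G.
Proof. by case/andP=> /edge_nontarget. Qed.

Lemma nontarget_edge v : v \notin targets G -> exists w, edge v w.
Proof. by rewrite inE => /eqP/nontarget_succ. Qed.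

Lemma nontarget_sedge tau v : v \notin targets G -> exists w, sedge tau v w.
Proof.
move=> vT; rewrite /sedge; have [cv|ncv] := boolP (controls P v).
  by exists (tau v); rewrite choice_edge ?eqxx.
by have [w evw] := nontarget_edge vT; exists w; rewrite evw.
Qed.

Lemma play_init tau p : plays tau p -> vertex_at p 0 = Some (init G).
Proof. by case; case: p => [[|v s]|f] //= [-> //]. Qed.

Lemma vertex_at_pred p i v : vertex_at p i.+1 = Some v ->
  exists w, vertex_at p i = Some w.
Proof.
case: p => [s|f]; last by exists (f i).
rewrite /vertex_at => sv; have : onth s i.+1 by rewrite sv.
rewrite onthTE => /ltnW; rewrite -(onthTE s i); case: onth => // w _.
by exists w.
Qed.

Lemma play_sedge tau p i v w : plays tau p ->
  vertex_at p i = Some v -> vertex_at p i.+1 = Some w -> sedge tau v w.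
Proof.
move=> [pp fp] pv pw; rewrite /sedge; apply/andP; split; last first.
  by apply/implyP => cv; apply/eqP/(fp _ _ _ pv pw cv).
case: p pp {fp} pv pw => [[|x s]|f] //=; last by move=> [_ ef] [<-] [<-].
move=> [_ /(pathP x) ps _] pv pw.
have si : i < size s by have := onthTE s i; rewrite pw.
by have := ps i si; rewrite (onth_nth _ _ _ _ pw) (onth_nth _ _ _ _ pv).
Qed.

Lemma play_end tau p i v : plays tau p ->
  vertex_at p i = Some v -> vertex_at p i.+1 = None -> v \in targets G.
Proof.
case=> + _; case: p => [[|x s]|f] //= [_ _ lT] pv pn.
have : i < size (x :: s) by rewrite -onthTE pv.
have : size s <= i by rewrite -onthNE pn.
rewrite /= ltnS => si is_; have is_eq : i = size s by apply/eqP; rewrite eqn_leq si is_.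
by rewrite -(onth_nth x _ _ _ pv) is_eq nth_last.
Qed.

Lemma play_target tau p i v : plays tau p ->
  vertex_at p i = Some v -> v \in targets G -> vertex_at p i.+1 = None.
Proof.
move=> pp pv vT; case pw : vertex_at => [w|] //.
by have /sedge_nontarget := play_sedge pp pv pw; rewrite vT.
Qed.

Lemma play_connect tau p i j v w : plays tau p ->
  vertex_at p i = Some v -> vertex_at p (i + j) = Some w -> connect (sedge tau) v w.
Proof.
move=> pp pv; elim: j w => [|j IH] w; first by rewrite addn0 pv => -[->].
rewrite addnS => pw; have [u pu] := vertex_at_pred pw.
by rewrite (connect_trans (IH _ pu)) // connect1 // (play_sedge pp pu pw).
Qed.

Lemma play_connect_init tau p i v : plays tau p ->
  vertex_at p i = Some v -> connect (sedge tau) (init G) v.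
Proof. by move=> pp pv; apply: (play_connect (j := i) pp (play_init pp)). Qed.

Lemma play_fin tau p i v : plays tau p -> vertex_at p i = Some v ->
  v \in targets G -> exists s, p = Fin (rcons s v).
Proof.
move=> pp pv vT; have := play_target pp pv vT.
case: p pp pv => [s|f] // _; rewrite /vertex_at => sv sn; exists (take i s); congr Fin.
have si : i < size s by rewrite -onthTE sv.
have is_ : size s <= i.+1 by rewrite -onthNE sn.
rewrite -[LHS](take_oversize is_) (take_nth v) //.
by rewrite (onth_nth _ _ _ _ sv).
Qed.

Lemma ends_in_visits tau p : plays tau p ->
  ends_in p (targets G) <-> visits p (targets G).
Proof.
move=> pp; split=> [[s [v [-> vT]]]|[i [v [pv vT]]]].
  by exists (size s), v; rewrite /= -cats1 onth_cat ltnn subnn.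
by have [s ps] := play_fin pp pv vT; exists s, v.
Qed.

(** The sequence is total but constrained only at nontargets: it is cut at its first target if there
    is one, and taken as an infinite play otherwise. *)
Lemma play_of_walk tau (f : nat -> G) : f 0 = init G ->
    (forall i, f i \notin targets G -> sedge tau (f i) (f i.+1)) ->
  exists p, plays tau p /\
    forall i, (forall j, j < i -> f j \notin targets G) -> vertex_at p i = Some (f i).
Proof.
move=> f0 ef; have [fT|fN] := pselect (exists i, f i \in targets G); last first.
  have fnT i : f i \notin targets G by apply/negP=> fi; apply: fN; exists i.
  exists (Inf f); split=> //; split.
    by split=> // i; have /andP[] := ef _ (fnT i).
  by move=> i v w [<-] [<-] cv; have /andP[_ /implyP/(_ cv)/eqP] := ef _ (fnT i).
have [m mT mmin] := ex_minnP fT.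
have nT j : j < m -> f j \notin targets G.
  by move=> jm; apply/negP=> /mmin; rewrite leqNgt jm.
have fat i : i <= m -> onth (mkseq f m.+1) i = Some (f i).
  by move=> im; rewrite onthE -map_comp (nth_map 0) ?size_iota // nth_iota.
have fsize : size (mkseq f m.+1) = m.+1 by rewrite size_mkseq.
exists (Fin (mkseq f m.+1)); split; last first.
  move=> i fi /=; apply: fat; rewrite leqNgt; apply/negP=> /fi.
  by rewrite mT.
split.
  rewrite /=; split=> //.
  - apply/(pathP (init G)) => i; rewrite size_map size_iota => im.
    have -> : nth (init G) (f 0 :: [seq f i | i <- iota 1 m]) i = f i.
      exact: (@nth_mkseq _ (init G) f m.+1 i (ltnW im)).
    have -> : nth (init G) [seq f i | i <- iota 1 m] i = f i.+1.
      exact: (@nth_mkseq _ (init G) f m.+1 i.+1 im).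
    by have /andP[] := ef _ (nT _ im).
  - rewrite (last_nth (init G)) size_map size_iota.
    by rewrite (@nth_mkseq _ (init G) f m.+1 m (ltnSn m)).
move=> i v w; rewrite /vertex_at => iv iw cv.
have im : i < m by rewrite -ltnS -fsize -onthTE iw.
move: iv iw; rewrite !fat ?(ltnW im) // => -[vE] [<-].
rewrite -vE in cv *; by have /andP[_ /implyP/(_ cv)/eqP] := ef _ (nT _ im).
Qed.

Lemma sedge_extend tau v : exists h : nat -> G, h 0 = v /\
  forall i, h i \notin targets G -> sedge tau (h i) (h i.+1).
Proof.
have step u : exists w, u \notin targets G -> sedge tau u w.
  have [uT|uT] := boolP (u \in targets G); first by exists u.
  by have [w ew] := nontarget_sedge tau uT; exists w.
have [nxt nxtP] := boolp.choice step.
by exists (fun i => iter i nxt v); split=> // i /nxtP.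
Qed.

(** Puts any finite walk of the strategy graph on a play and lets the continuation be prescribed;
    the values of [h] after its first target are junk. *)
Lemma play_through tau s (h : nat -> G) : path (sedge tau) (init G) s ->
    h 0 = last (init G) s ->
    (forall i, h i \notin targets G -> sedge tau (h i) (h i.+1)) ->
  exists p, [/\ plays tau p,
    forall i, i <= size s -> vertex_at p i = Some (nth (init G) (init G :: s) i)
  & forall i, (forall j, j < i -> h j \notin targets G) ->
      vertex_at p (size s + i) = Some (h i)].
Proof.
move=> ps h0 eh; have [f [fs es fh]] := path_then ps h0.
have ef i : f i \notin targets G -> sedge tau (f i) (f i.+1).
  have [/es //|si] := ltnP i (size s).
  by rewrite -(subnKC si) -addnS !fh; apply: eh.
have [p [pp pf]] := play_of_walk (fs 0 (leq0n _)) ef.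
have sN j : j < size s -> f j \notin targets G by move/es/sedge_nontarget.
exists p; split=> // i => [si|hN].
  by rewrite -fs // pf // => j ji; rewrite sN // (leq_trans ji).
rewrite pf ?fh // => j ji; have [/sN //|sj] := ltnP j (size s).
by rewrite -(subnKC sj) fh hN // ltn_subLR.
Qed.

(** * Winning, losing and avoiding in terms of the strategy graph *)

Lemma wins_if p : wins P p =
  if P == Reach then ends_in p (targets G) else ~ visits p (targets G).
Proof. by case: P. Qed.

Lemma losesE tau p : plays tau p ->
  ~ wins P p <-> if P == Reach then ~ visits p (targets G) else visits p (targets G).
Proof.
move=> pp; rewrite wins_if; have := ends_in_visits pp.
case: (P == Reach) => -[ev ve].
  by split; [apply: contra_not ve|apply: contra_not ev].
by split=> [/contrapT|v nv].
Qed.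

Definition losing_walk (e : rel G) v : Prop :=
  if P == Reach then infinite_walk e v
  else exists2 t, t \in targets G & connect e v t.

Lemma unending_play tau p i : plays tau p -> ~ visits p (targets G) ->
  exists v, vertex_at p i = Some v.
Proof.
move=> pp nT; elim: i => [|i [v pv]]; first by exists (init G); apply: play_init pp.
case pn: (vertex_at p i.+1) => [w|]; first by exists w.
by case: nT; exists i, v; split=> //; apply: (play_end pp pv).
Qed.

Lemma losing_visitP tau C :
  (exists p, [/\ plays tau p, visits p C & ~ wins P p]) <->
  exists2 v, v \in C & connect (sedge tau) (init G) v /\ losing_walk (sedge tau) v.
Proof.
rewrite /losing_walk; split=> [[p [pp [i [v [pv vC]]] /(losesE pp)]]|].
  move=> pl; exists v => //; split; first exact: play_connect_init pp pv.
  case: ifP pl => _ => [nT|[j [t [pt tT]]]].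
    have [h hP] := boolp.choice (fun j => unending_play j pp nT).
    have pS j : vertex_at p j = Some (h j) := hP j.
    exists (fun j => h (i + j)) => [|j]; first by move: pv; rewrite addn0 pS => -[].
    by rewrite addnS; apply: (play_sedge pp).
  exists t => //; have [ij|ji] := leqP i j.
    by apply: (play_connect (j := j - i) pp pv); rewrite subnKC.
  (* Targets are terminal, so a target met before position [i] would leave no vertex at position
     [i]. *)
  have pN k : vertex_at p (j + k.+1) = None.
    elim: k => [|k IH]; first by rewrite addn1 (play_target pp pt tT).
    case pk: vertex_at => [w|] //; move: pk; rewrite addnS => /vertex_at_pred[u].
    by rewrite IH.
  by move: pv; rewrite -(subnKC ji) addSnnS pN.
case=> v vC [/connectP[s ps sv]].
(* The continuation after [v] is chosen to witness the loss whenever there is one: an infinite walk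
   for Reach, a path to a target with an arbitrary prolongation for Safe. *)
have pick : exists h : nat -> G, [/\ h 0 = v,
    forall i, h i \notin targets G -> sedge tau (h i) (h i.+1) &
    (if P == Reach then infinite_walk (sedge tau) v
     else exists2 t, t \in targets G & connect (sedge tau) v t) ->
    if P == Reach then forall i, h i \notin targets G
    else exists i, h i \in targets G /\ forall j, j < i -> h j \notin targets G].
  have [h [h0 eh]] := sedge_extend tau v.
  case: ifP => _.
    have [[g g0 eg]|nw] := pselect (infinite_walk (sedge tau) v); last by exists h.
    by exists g; split=> // _ i; apply: sedge_nontarget (eg i).
  have [[t tT /connectP[r pr rt]]|nw] :=
    pselect (exists2 t, t \in targets G & connect (sedge tau) v t); last by exists h.
  have [k [k0 ek]] := sedge_extend tau t.
  have [f [fs es fh]] := path_then pr (etrans k0 rt).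
  exists f; split=> [|i|_]; first by rewrite fs.
    have [/es //|ri] := ltnP i (size r).
    by rewrite -(subnKC ri) -addnS !fh; apply: ek.
  exists (size r); split=> [|j /es/sedge_nontarget //].
  by rewrite -[size r]addn0 fh k0.
have [h [h0 eh hP]] := pick => vl; have {hP pick} := hP vl => hP.
have [p [pp pfirst pnext]] := play_through ps (etrans h0 sv) eh.
have visC : visits p C.
  by exists (size s), v; split=> //; rewrite -[size s]addn0 pnext // h0.
exists p; split=> //; apply/(losesE pp); case: ifP hP => _.
  move=> hN [i [w [pw wT]]]; have [si|is_] := leqP (size s) i.
    move: pw; rewrite -(subnKC si) pnext // => -[wE].
    by have := hN (i - size s); rewrite wE wT.
  have [j [x [px xT]]] : visits p (targets G) by exists i, w.
  have := play_target pp pw wT; rewrite pfirst //.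
by case=> i [hT hN]; exists (size s + i), (h i); rewrite pnext.
Qed.

(** Every play visits the initial vertex, so this is [losing_visitP] for the set [[set init G]]. *)
Lemma winningP tau : winning tau <-> ~ losing_walk (sedge tau) (init G).
Proof.
split=> [win lw|nl p pp].
  have [|p [pp _ pl]] := (losing_visitP tau [set init G]).2; last exact: pl (win p pp).
  by exists (init G); rewrite ?inE.
apply: contrapT => pl; have [|v] := (losing_visitP tau [set init G]).1.
  exists p; split=> //; exists 0, (init G); rewrite (play_init pp).
  by rewrite finset.in_set1.
by rewrite finset.in_set1 => /eqP-> [_].
Qed.

Lemma avoidsP tau C :
  avoids tau C <-> forall v, v \in C -> ~~ connect (sedge tau) (init G) v.
Proof.
split=> [av v vC|av p pp [i [v [pv vC]]]]; last first.
  by have := av v vC; rewrite (play_connect_init pp pv).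
apply/negP=> /connectP[s ps sv]; have [h [h0 eh]] := sedge_extend tau v.
have [p [pp _ pnext]] := play_through ps (etrans h0 sv) eh.
by apply: (av p pp); exists (size s), v; rewrite -[size s]addn0 pnext // h0.
Qed.

End Plays.

(** * Attractors and avoiding strategies *)

Section Attractor.
Variables (G : game) (P : player).
Implicit Types (sigma tau : strategy G P) (C R A : {set G}) (v w : G).

(* The edges left when the choices of [sigma] are imposed on [R]. *)
Definition fedge sigma R : rel G :=
  fun v w => edge v w && ((v \in R) && controls P v ==> (w == sigma v)).

(** Targets fall under the existential branch and have no successor, so they can enter only through
    [C]. *)
Definition attractor_step sigma C R A : {set G} := C :|:
  [set v | if controls P v then [forall w, fedge sigma R v w ==> (w \in A)]
           else [exists w, fedge sigma R v w && (w \in A)]].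

Definition attractor sigma C R : {set G} := fixset (attractor_step sigma C R).

Definition hedge sigma R A : rel G :=
  fun v w => [&& fedge sigma R v w, v \notin A & w \notin A].

Definition agree_on sigma R tau : Prop :=
  forall v, v \in R -> controls P v -> tau v = sigma v.

Lemma attractor_step_mono sigma C R :
  {homo attractor_step sigma C R : X Y / X \subset Y}.
Proof.
move=> X Y /fintype.subsetP XY; apply: finset.setUS; apply/fintype.subsetP => v.
rewrite !inE; case: ifP => _.
  by move=> /forallP vX; apply/forallP=> w; apply/implyP=> /(implyP (vX w))/XY.
by case/existsP=> w /andP[vw /XY wY]; apply/existsP; exists w; rewrite vw.
Qed.

Lemma attractorE sigma C R : attractor_step sigma C R (attractor sigma C R) =
  attractor sigma C R.
Proof. exact: fixsetK (@attractor_step_mono _ _ _). Qed.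

Lemma sub_attractor sigma C R : C \subset attractor sigma C R.
Proof. by rewrite -attractorE finset.subsetUl. Qed.

Lemma outside_attractor sigma C R v : v \notin attractor sigma C R ->
  if controls P v then exists2 w, fedge sigma R v w & w \notin attractor sigma C R
  else forall w, fedge sigma R v w -> w \notin attractor sigma C R.
Proof.
rewrite -{1}attractorE inE negb_or inE => /andP[_]; case: ifP => _.
  by rewrite negb_forall => /existsP[w]; rewrite negb_imply => /andP[]; exists w.
by rewrite negb_exists => /forallP vA w vw; have := vA w; rewrite vw.
Qed.

(** The vertices from which [tau] can reach [C] form a set closed under the attractor step: at a
    vertex of [P], the edge chosen by [tau] is among the allowed ones, by agreement on [R]. *)
Lemma avoiding_outside_attractor sigma C R tau v : agree_on sigma R tau ->
  avoids tau C -> connect (sedge tau) (init G) v -> v \notin attractor sigma C R.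
Proof.
move=> agr /avoidsP av iv; apply/negP=> vA.
suff /fintype.subsetP/(_ v vA) : attractor sigma C R \subset
    [set u | [exists c, (c \in C) && connect (sedge tau) u c]].
  rewrite inE => /existsP[c /andP[/av cC vc]].
  by rewrite (connect_trans iv vc) in cC.
apply: fixset_ind => X /fintype.subsetP XY; apply/fintype.subsetP => u.
rewrite !inE => /orP[uC|].
  by apply/existsP; exists u; rewrite uC connect0.
have step w : sedge tau u w -> w \in X ->
    [exists c, (c \in C) && connect (sedge tau) u c].
  move=> uw /XY; rewrite inE => /existsP[c /andP[cC wc]].
  by apply/existsP; exists c; rewrite cC (connect_trans (connect1 uw)).
rewrite /sedge in step; case: ifP => cu; rewrite cu in step.
  move/forallP/(_ (tau u))/implyP=> uX; apply: (step (tau u)).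
    by rewrite choice_edge /=.
  apply: uX; rewrite /fedge choice_edge //=.
  by apply/implyP=> /andP[uR _]; rewrite agr.
by case/existsP=> w /andP[/andP[uw _] wX]; apply: (step w _ wX); rewrite uw.
Qed.

(** Three demands on each choice are compatible: follow [nxt] on [B], follow [sigma] on [R], never
    enter the attractor from outside. A [hedge] edge respects the other two demands, and at a vertex
    of [P] in [R] outside the attractor the only allowed edge, that of [sigma], stays outside. *)
Lemma avoiding_strategy sigma C R (B : G -> Prop) (nxt : G -> G) :
    let A := attractor sigma C R in
    init G \notin A ->
    (forall v, B v -> controls P v -> hedge sigma R A v (nxt v)) ->
  exists tau, [/\ agree_on sigma R tau, avoids tau C
    & forall v, B v -> controls P v -> tau v = nxt v].
Proof.
move=> A iA nxtP.
have pick v : exists w, controls P v -> [/\ edge v w, v \in R -> w = sigma v,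
    v \notin A -> w \notin A & B v -> w = nxt v].
  have [cv|_] := boolP (controls P v); last by exists v.
  have [Bv|nBv] := pselect (B v).
    exists (nxt v) => _; have /and3P[/andP[vw /implyP vR] vA wA] := nxtP v Bv cv.
    by split=> // inR; apply/eqP/vR; rewrite inR.
  have [vR|vR] := boolP (v \in R).
    exists (sigma v) => _; split=> //; first exact: choice_edge.
    move=> /outside_attractor; rewrite cv => -[w /andP[_ /implyP]].
    by rewrite vR cv => /(_ isT)/eqP->.
  (* Inside the attractor and off [R] nothing is demanded, so any edge will do. *)
  have [vA|vA] := boolP (v \in A).
    by exists (sigma v) => _; split=> //; rewrite ?choice_edge // (negPf vR).
  move: (outside_attractor vA); rewrite cv => -[w /andP[vw _] wA].
  by exists w => _; split=> //; rewrite (negPf vR).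
have [t tP] := boolp.choice pick.
have tedge v : controls P v -> edge v ([ffun u => t u] v).
  by move=> cv; rewrite ffunE; have [] := tP v cv.
exists (Strategy tedge); split=> [v vR cv||v Bv cv]; rewrite /= ?ffunE.
- by have [_ -> ] := tP v cv.
- apply/avoidsP => c cC; apply/negP=> ic.
  suff : c \notin A by rewrite (fintype.subsetP (sub_attractor sigma C R)).
  case/connectP: ic => s; elim/last_ind: s c {cC} => [|s w IH] c; first by move=> _ ->.
  rewrite rcons_path last_rcons => /andP[/IH/(_ erefl) vA + ->].
  rewrite /sedge /= ffunE => /andP[vw].
  have [cv /eqP->|ncv _] := boolP (controls P (last (init G) s)).
    by have [_ _ ->] := tP _ cv.
  move: (outside_attractor vA); rewrite (negPf ncv); apply.
  by rewrite /fedge vw (negPf ncv) andbF.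
- by have [_ _ _ ->] := tP v cv.
Qed.

Lemma avoiding_agreeingP sigma C R :
  (exists tau, avoids tau C /\ agree_on sigma R tau) <->
  init G \notin attractor sigma C R.
Proof.
split=> [[tau [av ag]]|iA]; first exact: (avoiding_outside_attractor ag av (connect0 _ _)).
have [|tau [ag av _]] := @avoiding_strategy sigma C R (fun=> False) id iA; first by [].
by exists tau.
Qed.

Lemma losing_walk_sub (e e' : rel G) :
    (forall u w, connect e (init G) u -> e u w -> e' u w) ->
  losing_walk P e (init G) -> losing_walk P e' (init G).
Proof.
move=> ee'; rewrite /losing_walk; case: ifP => _.
  exact: infinite_walk_sub_reachable.
by case=> t tT it; exists t => //; apply: connect_sub_reachable ee' it.
Qed.

Lemma hedge_sedge sigma R A tau v w : (controls P v -> tau v = w) ->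
  hedge sigma R A v w -> sedge tau v w.
Proof.
move=> tv /and3P[/andP[vw _] _ _]; rewrite /sedge vw.
by apply/implyP=> /tv->.
Qed.

Lemma losing_avoidingP sigma C R :
    let A := attractor sigma C R in
  (exists tau, [/\ avoids tau C, agree_on sigma R tau & ~ winning tau]) <->
  init G \notin A /\ losing_walk P (hedge sigma R A) (init G).
Proof.
move=> A; split=> [[tau [av ag nw]]|[iA]].
  have out := avoiding_outside_attractor ag av; split; first exact/out/connect0.
  move: nw => /(contra_not (winningP tau).2)/contrapT.
  apply: losing_walk_sub => u w iu /[dup] uw /andP[euw /implyP tuw].
  rewrite /hedge !out ?(connect_trans iu (connect1 uw)) // !andbT /fedge euw.
  by apply/implyP=> /andP[uR cu]; rewrite (eqP (tuw cu)) ag.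
suff tauP : losing_walk P (hedge sigma R A) (init G) ->
    exists tau, [/\ agree_on sigma R tau, avoids tau C
      & losing_walk P (sedge tau) (init G)].
  move=> /tauP[tau [ag av lw]]; exists tau; split=> //.
  by move=> /winningP; apply.
rewrite /losing_walk; case: ifP => _.
  (* From each vertex of [B] there is an edge that stays in [B]; fixing one per vertex makes the
     infinite walk memoryless. *)
  move=> iw; pose B v := infinite_walk (hedge sigma R A) v.
  have step v : exists w, B v -> hedge sigma R A v w /\ B w.
    have [[h h0 eh]|nB] := pselect (B v); last by exists v.
    exists (h 1) => _; split; first by rewrite -h0.
    by exists (h \o succn) => // i; apply: eh.
  have [nxt nxtP] := boolp.choice step.
  have [|tau [ag av tn]] := @avoiding_strategy sigma C R B nxt iA.
    by move=> v /nxtP[].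
  exists tau; split=> //.
  have inB i : B (iter i nxt (init G)) by elim: i => //= i /nxtP[].
  exists (fun i => iter i nxt (init G)) => // i /=.
  have [hi _] := nxtP _ (inB i); apply: hedge_sedge hi => cv; exact: tn.
case=> t + /connectP[s0 ps0 tE]; rewrite {t}tE.
(* On a simple path the next vertex is a function of the current one. As [s] is its own list shifted
   by one against [init G :: s], the index in the latter points to the successor in [s]. *)
case/shortenP: ps0 => s ps us _ lT.
pose B v := exists2 i, i < size s & v = nth (init G) (init G :: s) i.
pose nxt v := nth (init G) s (index v (init G :: s)).
have nxtE i : i < size s -> nxt (nth (init G) (init G :: s) i) = nth (init G) s i.
  by move=> si; rewrite /nxt index_uniq //= ltnW.
have [|tau [ag av tn]] := @avoiding_strategy sigma C R B nxt iA.
  by move=> v [i si ->] _; rewrite nxtE //; apply: (pathP (init G) ps).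
exists tau; split=> //; exists (last (init G) s) => //.
apply/connectP; exists s => //; apply/(pathP (init G)) => i si.
have hi := pathP (init G) ps i si; apply: hedge_sedge hi => cv.
by rewrite tn ?nxtE //; exists i.
Qed.

End Attractor.

(** * The Hausdorff prefix distance *)

Section Distance.
Variables (R : realType) (G : game) (P : player).
Implicit Types (sigma tau : strategy G P) (C : {set G}) (v w : G) (p q : vseq G).

Lemma common_prefixW (V : Type) (p q : vseq V) m n : m <= n ->
  common_prefix p q n -> common_prefix p q m.
Proof. by move=> mn cp i im; apply: cp; apply: leq_trans mn. Qed.

Lemma d_pref_cases (V : Type) (p q : vseq V) :
  vertex_at p =1 vertex_at q /\ d_pref R p q = 0%R \/
  ~ vertex_at p =1 vertex_at q /\
  exists m, [/\ d_pref R p q = (2 ^- m)%R, common_prefix p q m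
              & ~ common_prefix p q m.+1].
Proof.
rewrite /d_pref; case: asboolP => pq; [by left|right; split=> //].
have lcp : exists m, is_lcp_length p q m.
  have ex : exists m, ~~ `[< common_prefix p q m >].
    apply: contrapT => /forallNP all; apply: pq => i.
    have /negP := all i.+1; rewrite negbK => /asboolP/(_ i (ltnSn i)).
    by case.
  have [[|m] /asboolPn mN mmin] := ex_minnP ex; first by case: mN.
  exists m; split=> //; apply: contrapT => cp.
  by have := mmin m (introT (asboolPn _) cp); rewrite ltnn.
by exists (xget 0 (is_lcp_length p q)); have [] := xgetPex 0 lcp.
Qed.

Let half_le m n : m <= n -> (2 ^- n <= 2 ^- m :> R)%R.
Proof.
move=> mn; rewrite lef_pV2 ?posrE ?exprn_gt0 ?ltr0n //.
by rewrite ler_weXn2l // ler1n.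
Qed.

(** Equal finite plays shorter than [k] have no common prefix of length [k]; the first alternative
    accounts for them. *)
Lemma d_pref_le (V : Type) (p q : vseq V) k :
  vertex_at p =1 vertex_at q \/ common_prefix p q k -> (d_pref R p q <= 2 ^- k)%R.
Proof.
have [[_ ->] _|[neq [m [-> _ mN]]]] := d_pref_cases p q.
  by rewrite invr_ge0 exprn_ge0 // ler0n.
case=> [//|cp]; apply: half_le; rewrite leqNgt; apply/negP => mk.
exact/mN/(common_prefixW mk).
Qed.

Lemma d_pref_ge (V : Type) (p q : vseq V) k : ~ common_prefix p q k.+1 ->
  ~ vertex_at p =1 vertex_at q -> (2 ^- k <= d_pref R p q)%R.
Proof.
have [[]//|[_ [m [-> cm _]]] nk _] := d_pref_cases p q.
by apply: half_le; rewrite leqNgt; apply/negP => /common_prefixW/(_ cm).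
Qed.

(* The vertices reached by a walk with fewer than [k] edges. *)
Definition layers sigma k : {set G} :=
  iter k (fun X => init G |: post (sedge sigma) X) finset.set0.

Lemma layers_mono sigma j k : j <= k -> layers sigma j \subset layers sigma k.
Proof. by apply: subset_iter => X Y; apply: setU_mono; apply: post_mono. Qed.

Lemma play_layers sigma p i v : plays sigma p -> vertex_at p i = Some v ->
  v \in layers sigma i.+1.
Proof.
move=> pp; elim: i v => [|i IH] v pv.
  by move: pv; rewrite (play_init pp) => -[<-]; rewrite !inE eqxx.
have [u pu] := vertex_at_pred pv.
rewrite /layers iterS !inE; apply/orP; right; apply/existsP; exists u.
by rewrite (play_sedge pp pu pv) IH.
Qed.

Lemma layersP sigma k v : v \in layers sigma k ->
  exists s, [/\ path (sedge sigma) (init G) s, last (init G) s = v & size s < k].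
Proof.
elim: k v => [|k IH] v; rewrite ?inE //= => /orP[/eqP->|/existsP[u /andP[uv /IH]]].
  by exists [::].
case=> s [ps su sk]; exists (rcons s v).
by rewrite rcons_path last_rcons size_rcons ps su.
Qed.

(** Layer [j.+1] depends only on the choices made on layer [j]; hence one layer more than the
    agreement itself. *)
Lemma layers_agree sigma tau k : agree_on sigma (layers sigma k) tau ->
  forall j, j <= k.+1 -> layers tau j = layers sigma j.
Proof.
move=> ag; elim=> [|j IH] // jk; rewrite /layers !iterS -!/(layers _ _) IH 1?ltnW //.
congr (_ |: _); apply/setP => v; rewrite !inE; apply: eq_existsb => u.
case: (boolP (u \in _)) => [uj|]; rewrite ?andbF // !andbT /sedge.
case: (boolP (controls P u)) => cu //; rewrite ag //.
exact: (fintype.subsetP (@layers_mono sigma j k jk) u uj).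
Qed.

(** Reduces the second half of the Hausdorff maximum to the first. *)
Lemma agree_sym sigma tau k : agree_on sigma (layers sigma k) tau ->
  agree_on tau (layers tau k) sigma.
Proof.
by move=> ag v; rewrite (layers_agree ag) // => vk cv; rewrite ag.
Qed.

(** The vertices at positions below [k] lie in layer [k], so the first [k] edges are also edges of
    [tau]. A play that meets a target by position [k] is itself a [tau]-play; any other is cut after
    [k] edges, that is [k.+1] vertices, and prolonged by [tau]. *)
Lemma agree_close sigma tau k p : agree_on sigma (layers sigma k) tau ->
  plays sigma p -> exists q, plays tau q /\
    (vertex_at p =1 vertex_at q \/ common_prefix p q k.+1).
Proof.
move=> ag pp; have inL i v : i < k -> vertex_at p i = Some v -> v \in layers sigma k.
  by move=> ik /(play_layers pp); apply: fintype.subsetP; apply: layers_mono.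
have [[i [v [ik pv vT]]]|nT] :=
    pselect (exists i v, [/\ i <= k, vertex_at p i = Some v & v \in targets G]).
  exists p; split; last by left.
  case: (pp) => ip fp; split=> // j u w pu pw cu.
  have ji : j < i.
    rewrite ltnNge; apply/negP => ij; have pN l : vertex_at p (i + l.+1) = None.
      elim: l => [|l IH]; first by rewrite addn1 (play_target pp pv vT).
      by case pk: vertex_at => [x|] //; move: pk; rewrite addnS => /vertex_at_pred[?]; rewrite IH.
    by move: pw; rewrite -(subnKC ij) -addnS pN.
  by rewrite ag ?(fp _ _ _ pu pw cu) // (inL j) // (leq_trans ji).
have pS i : exists v, i <= k -> vertex_at p i = Some v.
  suff : i <= k -> exists v, vertex_at p i = Some v.
    by have [_ /(_ isT)[v pv]|_] := leqP i k; [exists v|exists (init G)].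
  elim: i => [|i IH] ik; first by exists (init G); apply: play_init pp.
  have [v pv] := IH (ltnW ik).
  case pn: (vertex_at p i.+1) => [w|]; first by exists w.
  by case: nT; exists i, v; split; [exact: ltnW|exact: pv|exact: play_end pp pv pn].
have [h hP] := boolp.choice pS.
have h0 : h 0 = init G by have := hP 0 (leq0n _); rewrite (play_init pp) => -[].
pose s := mkseq (fun i => h i.+1) k.
have ss : size s = k by rewrite size_mkseq.
have hs i : i <= k -> nth (init G) (init G :: s) i = h i.
  by case: i => [|i] ik; rewrite ?h0 //= nth_mkseq.
have ps : path (sedge tau) (init G) s.
  apply/(pathP (init G)) => i; rewrite ss => ik.
  rewrite hs 1?ltnW // -[nth _ s i]/(nth (init G) (init G :: s) i.+1) hs //.
  have := play_sedge pp (hP i (ltnW ik)) (hP i.+1 ik).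
  rewrite /sedge; case: (boolP (controls P (h i))) => ci //.
  by rewrite ag // (inL i) // hP // ltnW.
have [g [g0 eg]] := sedge_extend tau (last (init G) s).
have [q [qq qs _]] := play_through ps g0 eg.
exists q; split=> //; right => i ik; rewrite hP // qs ?ss // hs //.
Qed.

Lemma d_pref_H_le sigma tau k : agree_on sigma (layers sigma k) tau ->
  (d_pref_H R sigma tau <= (2 ^- k.+1)%:E)%E.
Proof.
move=> ag; rewrite /d_pref_H ge_max; apply/andP; split.
  apply: ge_ereal_sup => _ [p pp <-]; have [q [qq pq]] := agree_close ag pp.
  apply: ge_ereal_inf; exists (d_pref R p q)%:E; first by exists q.
  by rewrite lee_fin d_pref_le.
apply: ge_ereal_sup => _ [q qq <-]; have [p [pp pq]] := agree_close (agree_sym ag) qq.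
apply: ge_ereal_inf; exists (d_pref R p q)%:E; first by exists p.
rewrite lee_fin d_pref_le //; case: pq => [pq|cp]; [by left=> i|right=> i ik].
by have [qi <-] := cp i ik.
Qed.

(** Some [sigma]-play has [v] at a position of at most [k] and [sigma v] next. A [tau]-play that
    shares the vertices up to [v] moves elsewhere, so at most [k.+1] vertices are common. The first
    half of the maximum suffices. *)
Lemma d_pref_H_ge sigma tau k v : v \in layers sigma k.+1 -> controls P v ->
  tau v <> sigma v -> ((2 ^- k.+1)%:E <= d_pref_H R sigma tau)%E.
Proof.
move=> /layersP[s [ps sv sk]] cv neq; rewrite /d_pref_H le_max; apply/orP; left.
have [h [h0 eh]] := sedge_extend sigma (sigma v).
have pr : path (sedge sigma) (init G) (rcons s (sigma v)).
  by rewrite rcons_path ps sv /sedge choice_edge // eqxx implybT.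
have [p [pp pS _]] := play_through pr (etrans h0 (esym (last_rcons _ _ _))) eh.
have p1 : vertex_at p (size s) = Some v.
  rewrite pS ?size_rcons // -rcons_cons nth_rcons /= ltnSn.
  by rewrite -sv (last_nth (init G)).
have p2 : vertex_at p (size s).+1 = Some (sigma v).
  by rewrite pS ?size_rcons // -rcons_cons nth_rcons /= ltnn eqxx.
apply: le_ereal_sup_tmp; eexists; first by exists p.
apply: le_ereal_inf_tmp => _ [q qq <-]; rewrite lee_fin.
have contra : vertex_at p (size s) = vertex_at q (size s) ->
    vertex_at p (size s).+1 = vertex_at q (size s).+1 -> False.
  rewrite p1 p2 => /esym q1 /esym q2; have := play_sedge qq q1 q2.
  by rewrite /sedge cv /= eq_sym => /andP[_ /eqP].
apply: d_pref_ge => [cp|pq]; last exact: contra.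
have [_ c1] := cp (size s) (leq_trans sk (leqnSn _)); have [_ c2] := cp (size s).+1 sk.
exact: contra c1 c2.
Qed.

Lemma agree_or_differ sigma tau (X : {set G}) : ~ agree_on sigma X tau ->
  exists2 v, v \in X & controls P v /\ tau v <> sigma v.
Proof.
move=> nag; apply: contrapT => nex; apply: nag => v vX cv; apply: contrapT => neq.
by apply: nex; exists v.
Qed.

(** The avoiding strategies that agree on layer [k] are all at distance exactly [2 ^- k.+1], since
    none of them agrees on layer [k.+1]; disagreement on layer [k] costs at least twice as much. *)
Lemma minimal_avoidingP sigma C k tau :
    (exists tau, avoids tau C /\ agree_on sigma (layers sigma k) tau) ->
    ~ (exists tau, avoids tau C /\ agree_on sigma (layers sigma k.+1) tau) ->
  minimal_avoiding (@d_pref_H R G P) sigma C tau <->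
  avoids tau C /\ agree_on sigma (layers sigma k) tau.
Proof.
move=> [tau0 [av0 ag0]] nk; split=> [[av tmin]|[av ag]]; split=> //; last first.
  move=> tau' av'; apply: (le_trans (d_pref_H_le ag)).
  have [|v vk [cv neq]] := @agree_or_differ sigma tau' (layers sigma k.+1).
    by move=> ag'; apply: nk; exists tau'.
  exact: d_pref_H_ge vk cv neq.
apply: contrapT => /agree_or_differ[v + [cv neq]]; case: k => [|k] in ag0 nk *.
  by rewrite /layers /= inE.
move=> /d_pref_H_ge/(_ cv neq) ge; have := le_trans ge (tmin tau0 av0).
move=> /le_trans/(_ (d_pref_H_le ag0)); rewrite lee_fin leNgt => /negP; apply.
by rewrite ltf_pV2 ?posrE ?exprn_gt0 ?ltr0n // ltr_eXn2l // ltr1n.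
Qed.

(** * Counterfactual causes in terms of levels *)

Definition causal_premise sigma C :=
  exists2 v, v \in C & connect (sedge sigma) (init G) v /\ losing_walk P (sedge sigma) v.

Lemma cause_premise sigma C :
  counterfactual_cause (@d_pref_H R G P) sigma C -> causal_premise sigma C.
Proof. by case=> /losing_visitP. Qed.

Lemma cause_avoidable sigma C : counterfactual_cause (@d_pref_H R G P) sigma C ->
  init G \notin attractor sigma C (layers sigma 0).
Proof.
case=> _ [tau av] _; apply/avoiding_agreeingP; exists tau; split=> // v.
by rewrite /layers /= inE.
Qed.

Lemma cause_level sigma C k :
    let X := layers sigma k in
    causal_premise sigma C -> init G \notin attractor sigma C X ->
    init G \in attractor sigma C (layers sigma k.+1) ->
  counterfactual_cause (@d_pref_H R G P) sigma C <->
  ~ losing_walk P (hedge sigma X (attractor sigma C X)) (init G).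
Proof.
move=> X prem iX iX'; have exX := (avoiding_agreeingP sigma C X).2 iX.
have nX' : ~ exists tau, avoids tau C /\ agree_on sigma (layers sigma k.+1) tau.
  by move/avoiding_agreeingP; rewrite iX'.
split=> [[_ _ win] lw|nl].
  have [tau [av ag nw]] := (losing_avoidingP sigma C X).2 (conj iX lw).
  by apply/nw/win/(minimal_avoidingP tau exX nX').
split; first exact/losing_visitP; first by have [tau [av _]] := exX; exists tau.
move=> tau /(minimal_avoidingP tau exX nX')[av ag]; apply: contrapT => nw; apply: nl.
suff [] : init G \notin attractor sigma C X /\
  losing_walk P (hedge sigma X (attractor sigma C X)) (init G) by [].
by apply/losing_avoidingP; exists tau.
Qed.

(** With stable layers, [sigma] is imposed on everything it reaches. Its walk into [C], provided by
    condition (1), is then drawn into the attractor vertex by vertex, backwards from [C]. This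
    bounds the search for the best level. *)
Lemma attractor_stable sigma C k : layers sigma k.+1 = layers sigma k ->
  causal_premise sigma C -> init G \in attractor sigma C (layers sigma k).
Proof.
move=> stab [v vC [/connectP[s ps sv] _]]; set X := layers sigma k.
have iX : init G \in X by rewrite /X -stab !inE eqxx.
have closed u w : u \in X -> sedge sigma u w -> w \in X.
  move=> uX uw; rewrite /X -stab /layers iterS !inE; apply/orP; right.
  by apply/existsP; exists u; rewrite uw.
elim: s (init G) iX ps sv => [|y s IH] x xX /=.
  by move=> _ <-; apply: (fintype.subsetP (sub_attractor _ _ _)).
move=> /andP[xy ys] sv; have yA := IH y (closed _ _ xX xy) ys sv.
rewrite -attractorE !inE; apply/orP; right.
case/andP: (xy) => exy /implyP cxy; case: ifP => cx.
  apply/forallP => w; apply/implyP => /andP[_ /implyP].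
  by rewrite xX cx => /(_ isT)/eqP->; rewrite -(eqP (cxy cx)).
by apply/existsP; exists y; rewrite /fedge exy cx andbF.
Qed.

End Distance.

(** * Graph automata *)

(* [inl i]: the i-th header bit of the vertex is set.  [inr (d, k, l)]: some
   neighbour along an arc of kind k is labelled l; the arc is outgoing if d is
   true, incoming otherwise. *)
Definition message (T : finType) : finType := ('I_4 + bool * bool * T)%type.

Record automaton := Automaton {
  glob : finType;
  lab : finType;
  lab0 : lab;
  glob0 : bool -> glob;
  upd : glob -> lab -> {set message lab} -> lab;
  advance : glob -> {set lab} -> glob;
  out : glob -> option bool
}.

Section Semantics.
Variables (U : automaton) (V : finType).
Variables (hdr : V -> 4.-tuple bool) (bit : bool -> rel V).

(** A set, without senders or multiplicities, so that the mailbox of a vertex fits into one tape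
    symbol. *)
Definition box (L : V -> lab U) (v : V) : {set message (lab U)} :=
  [set m : message (lab U) | match m with
    | inl i => tnth (hdr v) i
    | inr (d, k, l) => [exists w, (L w == l) && (if d then bit k v w else bit k w v)]
    end].

Definition relabel g (L : V -> lab U) v : lab U := upd g (L v) (box L v).

Definition gstep (c : glob U * (V -> lab U)) : glob U * (V -> lab U) :=
  if out c.1 is Some _ then c
  else (advance c.1 [set relabel c.1 c.2 v | v : V], relabel c.1 c.2).

Definition gstart (b : bool) : glob U * (V -> lab U) := (glob0 U b, fun=> lab0 U).

(** The layout is that of [encode_instance], which is convertible to an instance of it. *)
Definition graph_word (b : bool) : seq bool :=
  nseq #|V| true ++ [:: false; b] ++
  flatten [seq hdr v ++ [seq bit false v w | w <- enum V] ++
                        [seq bit true v w | w <- enum V] | v <- enum V].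

End Semantics.

(** * Tapes as functions *)

Section Tapes.
Variable aux : finType.
Local Notation sym := (tape_symbol aux).

(* The content and the head position.  The cells left of cell 0 are blank; a
   head leaving cell 0 to the left shifts the content instead. *)
Definition atape : Type := ((nat -> sym) * nat)%type.

Definition amove (t : atape) (m : move) : atape :=
  match m, t with
  | MoveLeft, (f, 0) => (fun i => if i is j.+1 then f j else None, 0)
  | MoveLeft, (f, p.+1) => (f, p)
  | Stay, _ => t
  | MoveRight, (f, p) => (f, p.+1)
  end.

Definition awrite (t : atape) (a : sym) : atape :=
  (fun i => if i == t.2 then a else t.1 i, t.2).

Definition aupd (t : atape) (am : sym * move) : atape := amove (awrite t am.1) am.2.

(** The default [None] of [nth] absorbs trailing blanks, on which the list representation is
    ambiguous. *)
Definition repr (t : tape aux) (x : atape) : Prop :=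
  [/\ scanned t = x.1 x.2,
      forall k, nth None (to_left t) k = if k < x.2 then x.1 (x.2 - k.+1) else None
    & forall k, nth None (to_right t) k = x.1 (x.2 + k.+1)].

Lemma repr_upd t x am : repr t x -> repr (update_tape t am) (aupd x am).
Proof.
case: t x am => l c r [f p] [a m] [/= cE lE rE].
case: m; rewrite /aupd /awrite /=.
- case: p => [|p] in cE lE rE *.
    split=> [|k|k] /=; first by rewrite -nth0 lE.
      by rewrite nth_behead lE.
    by case: k => [|k] /=; rewrite ?rE.
  split=> [|k|k] /=; first by rewrite -nth0 lE /= subSS subn0 ltn_eqF.
    rewrite nth_behead lE ltnS subSS; case: ifP => // kp.
    by rewrite ltn_eqF // ltnS leq_subr.
  case: k => [|k] /=; first by rewrite addn1 eqxx.
  by rewrite rE addSnnS gtn_eqF // !addnS !ltnS leq_addr.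
- split=> [|k|k] /=; first by rewrite eqxx.
    by rewrite lE; case: ifP => // kp; rewrite ltn_eqF // ltn_subrL /= (leq_trans _ kp).
  by rewrite rE gtn_eqF // addnS ltnS leq_addr.
- split=> [|k|k] /=; first by rewrite -nth0 rE addn1 gtn_eqF.
    case: k => [|k] /=; first by rewrite subSS subn0 eqxx.
    rewrite lE ltnS subSS; case: ifP => // kp.
    by rewrite ltn_eqF // ltn_subrL /= (leq_trans _ kp).
  by rewrite nth_behead rE addSnnS gtn_eqF // addnS ltnS leq_addr.
Qed.

Lemma aupd_same f p m : aupd (f, p) (f p, m) = amove (f, p) m.
Proof.
rewrite /aupd /awrite /=; congr (amove (_, _) m); apply/funext => i.
by case: eqP => [->|].
Qed.

(** Cell 0 stays blank and marks the left end, where rewinding stops. *)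
Definition lay (c : nat -> aux) (n : nat) : nat -> sym :=
  fun i => if i is j.+1 then if j < n then Some (inr (c j)) else None else None.

Lemma lay_ext c c' n : (forall i, i < n -> c i = c' i) -> lay c n = lay c' n.
Proof. by move=> cc; apply/funext => -[|i] //=; case: ifP => // /cc->. Qed.

Lemma awrite_lay c c' n j x : j < n ->
    (forall i, i < n -> c' i = if i == j then x else c i) ->
  awrite (lay c n, j.+1) (Some (inr x)) = (lay c' n, j.+1).
Proof.
move=> jn cc; rewrite /awrite /=; congr (_, _); apply/funext => -[|i] //=.
rewrite eqSS; case: (ltnP i n) => [/cc->|ni]; first by case: eqP.
by rewrite gtn_eqF // (leq_trans jn).
Qed.

Lemma lay_cell c n i : lay c n i.+1 = if i < n then Some (inr (c i)) else None.
Proof. by []. Qed.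

End Tapes.

(** * The machine simulating a graph automaton *)

(* Tape 0 is the input; tapes 1 and 2 hold a cell per vertex with its label and
   the messages received so far, incoming ones and outgoing ones respectively.
   A round consists of: [Sweep] along the leading ones of the input, relabelling
   the vertices; [Player]; [Home], rewinding tapes 1 and 2; then for each vertex
   its header bits [Header] and its rows [Row], each of which is read in parallel
   with tape 1 and is followed by [Back], rewinding tape 1; and finally [Rewind]. *)
Inductive control := Sweep | Player | Home | Rewind
  | Header of 'I_4 | Row of bool | Back of bool.

Definition control_code (p : control) : 'I_4 + bool * bool + bool * bool :=
  match p with
  | Header i => inl (inl i)
  | Row k => inl (inr (true, k))
  | Back k => inl (inr (false, k))
  | Sweep => inr (true, true)
  | Player => inr (true, false)
  | Home => inr (false, true)
  | Rewind => inr (false, false)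
  end.

Definition control_decode (x : 'I_4 + bool * bool + bool * bool) : control :=
  match x with
  | inl (inl i) => Header i
  | inl (inr (true, k)) => Row k
  | inl (inr (false, k)) => Back k
  | inr (true, true) => Sweep
  | inr (true, false) => Player
  | inr (false, true) => Home
  | inr (false, false) => Rewind
  end.

Lemma control_codeK : cancel control_code control_decode.
Proof. by case. Qed.

HB.instance Definition _ := Finite.copy control (can_type control_codeK).

Lemma answers_leq (M : machine) w t u b : t <= u -> answers_within M w t b -> answers_within M w u b.
Proof.
move=> tu; rewrite /answers_within -(subnK tu) iterD.
case: (iter t _ _) => q ts /= qb; elim: (u - t) => //= k IH.
by case: (iter k _ _) IH => q' ts' /= q'b; rewrite q'b.
Qed.

Section Simulator.
Variable U : automaton.

Definition cell : finType := (lab U * {set message (lab U)})%type.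
Local Notation sym := (tape_symbol cell).

(** The global state is absent until the first sweep has laid out the cells; the set accumulates the
    labels written during a sweep. *)
Definition sim_state : finType := (control * option (glob U) * {set lab U})%type.

Definition receive (c : cell) (b : bool) (m : message (lab U)) : cell :=
  if b then (c.1, m |: c.2) else c.

(** Lets a short tape wait on its blank cell 0 while the input is rewound. *)
Definition leftwards (a : sym) : sym * move :=
  (a, if a is Some _ then MoveLeft else Stay).

(** Blanks are the end markers: on tape 1 they end a row and its rewinding, on tape 0 the whole
    input. The cells exist on two tapes so that both ends of an arc are scanned at once: tape 2
    stands on the row vertex, tape 1 on the column vertex, and each receives the label of the
    other. *)
Definition sim_delta (q : sim_state) (a0 a1 a2 : sym) :
    sim_state * (sym * move) * (sym * move) * (sym * move) :=
  let: (p, g, s) := q in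
  match p with
  | Sweep =>
    if a0 is Some (inl true) then
      let l := match a1, a2, g with
               | Some (inr c1), Some (inr c2), Some g' => upd g' c1.1 (c1.2 :|: c2.2)
               | _, _, _ => lab0 U
               end in
      let c := Some (inr (l, finset.set0)) in
      ((Sweep, g, l |: s), (a0, MoveRight), (c, MoveRight), (c, MoveRight))
    else ((Player, g, s), (a0, MoveRight), (a1, MoveLeft), (a2, MoveLeft))
  | Player =>
    let b := if a0 is Some (inl true) then true else false in
    ((Home, Some (if g is Some g' then advance g' s else glob0 U b), finset.set0),
      (a0, MoveRight), (a1, Stay), (a2, Stay))
  | Home =>
    if a1 is Some _ then (q, (a0, Stay), (a1, MoveLeft), (a2, MoveLeft))
    else ((Header ord0, g, s), (a0, Stay), (a1, MoveRight), (a2, MoveRight))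
  | Header i =>
    match a0, a2 with
    | Some (inl b), Some (inr c2) =>
      ((if i < 3 then Header (inord i.+1) else Row false, g, s), (a0, MoveRight),
        (a1, Stay), (Some (inr (receive c2 b (inl i))), Stay))
    | _, _ => ((Rewind, g, s), (a0, MoveLeft), (a1, MoveLeft), (a2, MoveLeft))
    end
  | Row k =>
    match a0, a1, a2 with
    | Some (inl b), Some (inr c1), Some (inr c2) =>
      (q, (a0, MoveRight),
        (Some (inr (receive c1 b (inr (false, k, c2.1)))), MoveRight),
        (Some (inr (receive c2 b (inr (true, k, c1.1)))), Stay))
    | _, _, _ => ((Back k, g, s), (a0, Stay), (a1, MoveLeft), (a2, Stay))
    end
  | Back k =>
    if a1 is Some _ then (q, (a0, Stay), (a1, MoveLeft), (a2, Stay))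
    else if k then ((Header ord0, g, s), (a0, Stay), (a1, MoveRight), (a2, MoveRight))
    else ((Row true, g, s), (a0, Stay), (a1, MoveRight), (a2, Stay))
  | Rewind =>
    if a0 is Some _ then (q, (a0, MoveLeft), leftwards a1, leftwards a2)
    else ((Sweep, g, s), (a0, MoveRight), (a1, MoveRight), (a2, MoveRight))
  end.

Definition sim_verdict (q : sim_state) : option bool :=
  if q is (Home, Some g, _) then out g else None.

Definition tape1 : 'I_3 := Ordinal (isT : 1 < 3).
Definition tape2 : 'I_3 := Ordinal (isT : 2 < 3).

Definition simulator : machine :=
  @Machine 2 cell sim_state (Sweep, None, finset.set0) sim_verdict
    (fun q a => let: (q', x0, x1, x2) := sim_delta q (a ord0) (a tape1) (a tape2) in
                (q', fun i : 'I_3 => nth x0 [:: x0; x1; x2] i)).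

Definition aconfig : Type := (sim_state * atape cell * atape cell * atape cell)%type.

Definition scan (t : atape cell) : sym := t.1 t.2.

Definition astep (x : aconfig) : aconfig :=
  let: (q, t0, t1, t2) := x in
  if sim_verdict q is Some _ then x else
  let: (q', x0, x1, x2) := sim_delta q (scan t0) (scan t1) (scan t2) in
  (q', aupd t0 x0, aupd t1 x1, aupd t2 x2).

Definition crepr (c : config simulator) (x : aconfig) : Prop :=
  let: (q, t0, t1, t2) := x in
  [/\ c.1 = q, repr (c.2 ord0) t0, repr (c.2 tape1) t1 & repr (c.2 tape2) t2].

Lemma crepr_step c x : crepr c x -> crepr (@step simulator c) (astep x).
Proof.
case: c x => q ts [[[q' t0] t1] t2] /= [<- r0 r1 r2].
have [s0 _ _] := r0; have [s1 _ _] := r1; have [s2 _ _] := r2.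
case: (sim_verdict q) => [b|] //; rewrite s0 s1 s2 -!/(scan _).
case: sim_delta => [[[q'' x0] x1] x2] /=.
by split=> //; apply: repr_upd.
Qed.

Lemma crepr_iter t c x : crepr c x -> crepr (iter t (@step simulator) c) (iter t astep x).
Proof. by move=> cx; elim: t => //= t; apply: crepr_step. Qed.

(** Shifted by one cell, so that the input too has a blank cell 0; all three heads start on cell
    1. *)
Definition input (w : seq bool) : nat -> sym :=
  fun i => if i is j.+1 then nth None [seq Some (inl b) | b <- w] j else None.

Lemma input_nth w j : j < size w -> input w j.+1 = Some (inl (nth false w j)).
Proof. by move=> jw; rewrite /input (nth_map false). Qed.

Lemma input_end w j : size w <= j -> input w j.+1 = None.
Proof. by move=> wj; rewrite /input nth_default // size_map. Qed.

Definition start_aconfig w : aconfig :=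
  ((Sweep, None, finset.set0), (input w, 1), (fun=> None, 1), (fun=> None, 1)).

Lemma crepr_start w : crepr (@start_config simulator w) (start_aconfig w).
Proof.
have blank : repr (Tape [::] None [::] : tape cell) (fun=> None, 1).
  by split=> //= k; rewrite ?if_same nth_nil.
split=> //; rewrite /= /input_tape /input; split=> //=.
- by move=> k; rewrite if_same nth_nil.
- by move=> k; rewrite nth_behead.
Qed.

Definition run t x y := exists2 t', t' <= t & iter t' astep x = y.

Lemma run_refl x : run 0 x x. Proof. by exists 0. Qed.

Lemma run_trans t u x y z : run t x y -> run u y z -> run (t + u) x z.
Proof.
move=> [t' tt <-] [u' uu <-]; exists (u' + t').
  by rewrite addnC leq_add.
by rewrite iterD.
Qed.

Lemma run_step x y : astep x = y -> run 1 x y. Proof. by exists 1. Qed.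

Lemma run_leq t u x y : t <= u -> run t x y -> run u x y.
Proof. by move=> tu [t' tt <-]; exists t' => //; apply: leq_trans tu. Qed.

Lemma run_loop T n (c : nat -> aconfig) : (forall i, i < n -> run T (c i) (c i.+1)) ->
  run (n * T) (c 0) (c n).
Proof.
elim: n => [|n IH] cn; first exact: run_refl.
rewrite mulSnr; apply: run_trans (cn n (ltnSn n)).
by apply: IH => i /ltnW; apply: cn.
Qed.

Lemma answers_run w t q t0 t1 t2 b : run t (start_aconfig w) (q, t0, t1, t2) ->
  sim_verdict q = Some b -> answers_within simulator w t b.
Proof.
move=> [t' tt eq] qb; apply: answers_leq tt _; rewrite /answers_within.
by have := crepr_iter t' (crepr_start w); rewrite eq => -[-> _ _ _].
Qed.

End Simulator.

Arguments input : simpl never.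
Arguments lay : simpl never.

(** * Reading the input word by position *)

Lemma nth_flatten_const (T : Type) (x : T) (m : nat) (ss : seq (seq T)) r i :
    all (fun s => size s == m) ss -> r < size ss -> i < m ->
  nth x (flatten ss) (r * m + i) = nth x (nth [::] ss r) i.
Proof.
elim: ss r => [|s ss IH] [|r] //= /andP[/eqP sm ssm] rs im; rewrite nth_cat sm.
  by rewrite im.
by rewrite mulSn -addnA ltnNge leq_addr /= addKn IH.
Qed.

Lemma size_flatten_const (T : Type) (m : nat) (ss : seq (seq T)) :
  all (fun s => size s == m) ss -> size (flatten ss) = size ss * m.
Proof.
by elim: ss => //= s ss IH /andP[/eqP sm ssm]; rewrite size_cat sm IH.
Qed.

Section Rounds.
Variables (U : automaton) (V : finType) (v0 : V).
Variables (hdr : V -> 4.-tuple bool) (bit : bool -> rel V) (b : bool).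
Implicit Types (L : V -> lab U) (D : bool -> rel V) (H : V -> pred 'I_4) (g : glob U).

Let n := #|V|.
Let w := graph_word hdr bit b.

Definition vtx i : V := nth v0 (enum V) i.
Definition rank (v : V) : nat := index v (enum V).

Lemma rank_lt v : rank v < n.
Proof. by rewrite /n cardE index_mem mem_enum. Qed.

Lemma rankK v : vtx (rank v) = v.
Proof. by rewrite /vtx nth_index // mem_enum. Qed.

Lemma vtxK i : i < n -> rank (vtx i) = i.
Proof. by rewrite /n cardE => ilt; rewrite /rank index_uniq ?enum_uniq. Qed.

Lemma eq_vtx v i : i < n -> (v == vtx i) = (rank v == i).
Proof. by move=> ilt; apply/eqP/eqP => [->|<-]; rewrite ?vtxK ?rankK. Qed.

(** Before block [r] come [n] ones, the separator, the player bit, and [r] blocks of 4 header bits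
    and two rows of [n] bits. *)
Definition row_pos r := n.+2 + r * (4 + (n + n)).

Let block v := tval (hdr v) ++ [seq bit false v x | x <- enum V] ++
                               [seq bit true v x | x <- enum V].

Let blockP : all (fun s => size s == 4 + (n + n)) [seq block v | v <- enum V].
Proof.
apply/allP => s /mapP[v _ ->].
by rewrite !size_cat size_tuple 2!size_map -cardE.
Qed.

Lemma size_word : size w = row_pos n.
Proof.
rewrite /w /graph_word !size_cat size_nseq /= (size_flatten_const blockP).
by rewrite size_map -cardE /row_pos !addnS addSn.
Qed.

Lemma word_one i : i < n -> nth false w i = true.
Proof. by move=> ilt; rewrite /w nth_cat size_nseq ilt nth_nseq ilt. Qed.

Lemma word_sep : nth false w n = false.
Proof. by rewrite /w nth_cat size_nseq ltnn subnn. Qed.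

Lemma word_player : nth false w n.+1 = b.
Proof. by rewrite /w nth_cat size_nseq ltnNge leqnSn /= subSnn. Qed.

Let word_block r i : r < n -> i < 4 + (n + n) ->
  nth false w (row_pos r + i) = nth false (block (vtx r)) i.
Proof.
move=> rn ib.
have -> : row_pos r + i = n + (r * (4 + (n + n)) + i).+2 by rewrite /row_pos; lia.
rewrite /w nth_cat size_nseq -/n ltnNge leq_addr /= addKn /=.
have rs : r < size (enum V) by rewrite -cardE.
rewrite (nth_flatten_const _ blockP) //; last by rewrite size_map.
by rewrite (nth_map v0).
Qed.

Lemma word_hdr r (i : 'I_4) : r < n ->
  nth false w (row_pos r + i) = tnth (hdr (vtx r)) i.
Proof.
move=> rn; rewrite word_block // ?ltn_addr // nth_cat size_tuple ltn_ord.
by rewrite (tnth_nth false).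
Qed.

Lemma word_bit r (k : bool) c : r < n -> c < n ->
  nth false w (row_pos r + (4 + k * n + c)) = bit k (vtx r) (vtx c).
Proof.
move=> rn cn; rewrite word_block //; last first.
  by case: k; rewrite ?mul1n ?mul0n ?addn0 -?addnA ltn_add2l ?ltn_add2l // ltn_addr.
rewrite -addnA nth_cat size_tuple ltnNge leq_addr /= addKn nth_cat size_map -cardE.
case: k; rewrite ?mul1n ?mul0n ?add0n ?cn.
  by rewrite ltnNge leq_addr /= addKn (nth_map v0) // -cardE.
by rewrite (nth_map v0) // -cardE.
Qed.

(** * Mailboxes during the pass over the input *)

Definition inbox D L v : {set message (lab U)} :=
  [set m : message (lab U) | if m is inr (false, k, l)
    then [exists u, (L u == l) && D k u v] else false].

Definition outbox H D L v : {set message (lab U)} :=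
  [set m : message (lab U) | match m with
    | inl i => H v i
    | inr (true, k, l) => [exists u, (L u == l) && D k v u]
    | _ => false
    end].

(** With [D] the arcs read so far, a half-filled tape is the full tape of a smaller graph, and
    reading one bit adds one arc. *)
Definition cell1 D L i : cell U := (L (vtx i), inbox D L (vtx i)).
Definition cell2 H D L i : cell U := (L (vtx i), outbox H D L (vtx i)).

Definition add_arc D (k : bool) v x (a : bool) : bool -> rel V :=
  fun k' v' x' => D k' v' x' || [&& a, k' == k, v' == v & x' == x].

Lemma exists_add (p q : pred V) y (a : bool) :
  [exists u, p u && (q u || a && (u == y))] = [exists u, p u && q u] || a && p y.
Proof.
apply/existsP/orP => [[u /andP[pu /orP[qu|/andP[-> /eqP<-]]]]|].
- by left; apply/existsP; exists u; rewrite pu.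
- by right.
- case=> [/existsP[u /andP[pu qu]]|/andP[-> py]]; first by exists u; rewrite pu qu.
  by exists y; rewrite py eqxx orbT.
Qed.

Lemma cell1_add D L k r c a i : i < n -> c < n ->
  cell1 (add_arc D k (vtx r) (vtx c) a) L i =
  if i == c then receive (cell1 D L c) a (inr (false, k, L (vtx r))) else cell1 D L i.
Proof.
move=> ilt clt; have main m : (m \in inbox (add_arc D k (vtx r) (vtx c) a) L (vtx i)) =
    (m \in inbox D L (vtx i)) || [&& i == c, a & m == inr (false, k, L (vtx r))].
  case: m => [j|[[[] k'] l]]; rewrite !inE //= ?andbF //.
  rewrite -[X in _ || X]/[&& i == c, a & (false, k', l) == (false, k, L (vtx r))].
  rewrite !xpair_eqE eqxx /= (eq_sym l) [LHS](eq_existsb (P2 := fun u => (L u == l) &&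
    (D k' u (vtx i) || [&& a, k' == k & i == c] && (u == vtx r)))); last first.
    move=> u; rewrite /add_arc (eq_vtx (vtx i) clt) vtxK //.
    by case: a; case: (k' == k); case: (u == vtx r); case: (i == c); rewrite ?andbF ?andbT.
  rewrite exists_add; congr (_ || _).
  by case: a; case: (k' == k); case: (i == c); rewrite ?andbF ?andbT.
rewrite /cell1 /receive; case: eqP main => [->|_] /= main; last first.
  by congr (_, _); apply/setP => m; rewrite main orbF.
case: a main => /= main; congr (_, _); apply/setP => m; rewrite main ?orbF //.
by rewrite !inE orbC.
Qed.

Lemma cell2_add H D L k r c a i : i < n -> r < n ->
  cell2 H (add_arc D k (vtx r) (vtx c) a) L i =
  if i == r then receive (cell2 H D L r) a (inr (true, k, L (vtx c))) else cell2 H D L i.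
Proof.
move=> ilt rlt; have main m : (m \in outbox H (add_arc D k (vtx r) (vtx c) a) L (vtx i)) =
    (m \in outbox H D L (vtx i)) || [&& i == r, a & m == inr (true, k, L (vtx c))].
  case: m => [j|[[[] k'] l]]; rewrite !inE //= ?andbF ?orbF //.
  rewrite -[X in _ || X]/[&& i == r, a & (true, k', l) == (true, k, L (vtx c))].
  rewrite !xpair_eqE eqxx /= (eq_sym l) [LHS](eq_existsb (P2 := fun u => (L u == l) &&
    (D k' (vtx i) u || [&& a, k' == k & i == r] && (u == vtx c)))); last first.
    move=> u; rewrite /add_arc (eq_vtx (vtx i) rlt) vtxK //.
    by case: a; case: (k' == k); case: (u == vtx c); case: (i == r); rewrite ?andbF ?andbT.
  rewrite exists_add; congr (_ || _).
  by case: a; case: (k' == k); case: (i == r); rewrite ?andbF ?andbT.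
rewrite /cell2 /receive; case: eqP main => [->|_] /= main; last first.
  by congr (_, _); apply/setP => m; rewrite main orbF.
case: a main => /= main; congr (_, _); apply/setP => m; rewrite main ?orbF //.
by rewrite !inE orbC.
Qed.

Definition add_hdr H v (j : 'I_4) (a : bool) : V -> pred 'I_4 :=
  fun v' j' => H v' j' || [&& a, v' == v & j' == j].

Lemma cell2_add_hdr H D L r j a i : i < n -> r < n ->
  cell2 (add_hdr H (vtx r) j a) D L i =
  if i == r then receive (cell2 H D L r) a (inl j) else cell2 H D L i.
Proof.
move=> ilt rlt; have main m : (m \in outbox (add_hdr H (vtx r) j a) D L (vtx i)) =
    (m \in outbox H D L (vtx i)) || [&& i == r, a & m == inl j].
  case: m => [j'|[[[] k'] l]]; rewrite !inE //= ?andbF ?orbF //.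
  rewrite /add_hdr eq_vtx // vtxK //; congr (_ || _).
  by case: a; case: (i == r); rewrite ?andbF ?andbT.
rewrite /cell2 /receive; case: eqP main => [->|_] /= main; last first.
  by congr (_, _); apply/setP => m; rewrite main orbF.
case: a main => /= main; congr (_, _); apply/setP => m; rewrite main ?orbF //.
by rewrite !inE orbC.
Qed.

(* The arcs already read when the next bit is the one of kind [k] in row [r] and
   column [c]. *)
Definition arcs r (k : bool) c : bool -> rel V := fun k' u x =>
  bit k' u x && ((rank u < r) ||
    (rank u == r) && ((k' < k) || (k' == k) && (rank x < c))).

Definition hdrs r i : V -> pred 'I_4 := fun v j =>
  tnth (hdr v) j && ((rank v < r) || (rank v == r) && (j < i)).

Let eq_bit (D D' : bool -> rel V) : (forall k u x, D k u x = D' k u x) -> D = D'.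
Proof. by move=> DD; do 3 (apply/funext => ?). Qed.

Lemma arcs_step r k c : r < n -> c < n ->
  arcs r k c.+1 = add_arc (arcs r k c) k (vtx r) (vtx c) (bit k (vtx r) (vtx c)).
Proof.
move=> rn cn; apply: eq_bit => k' u x; rewrite /add_arc /arcs !eq_vtx //.
rewrite ltnS [rank x <= c]leq_eqVlt; case: (rank u =P r) => [ur|]; rewrite ?andbF ?orbF //=.
case: (rank x =P c) => [xc|]; rewrite ?andbF ?orbF //=.
case: (k' =P k) => [->|]; rewrite ?andbF ?orbF //=.
by rewrite -ur -xc !rankK !ltnn; case: bit; case: k.
Qed.

Lemma arcs_turn r : arcs r false n = arcs r true 0.
Proof. by apply: eq_bit => -[] u x; rewrite /arcs rank_lt ?andbF ?andbT. Qed.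

Lemma arcs_next r : arcs r true n = arcs r.+1 false 0.
Proof.
apply: eq_bit => k u x; rewrite /arcs rank_lt ltn0 andbT andbF orbF ltnS.
by rewrite [rank u <= r]leq_eqVlt orbC; case: k; rewrite ?andbF ?andbT ?orbF.
Qed.

Lemma arcs_none : arcs 0 false 0 = fun _ _ _ => false.
Proof. by apply: eq_bit => k u x; rewrite /arcs !ltn0 !andbF. Qed.

Lemma arcs_all : arcs n false 0 = bit.
Proof. by apply: eq_bit => k u x; rewrite /arcs rank_lt andbT. Qed.

Let eq_hdr (H H' : V -> pred 'I_4) : (forall v j, H v j = H' v j) -> H = H'.
Proof. by move=> HH; do 2 (apply/funext => ?). Qed.

Lemma hdrs_step r (i : 'I_4) : r < n ->
  hdrs r i.+1 = add_hdr (hdrs r i) (vtx r) i (tnth (hdr (vtx r)) i).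
Proof.
move=> rn; apply: eq_hdr => v j; rewrite /add_hdr /hdrs eq_vtx //.
rewrite ltnS [j <= i]leq_eqVlt; case: (rank v =P r) => [vr|]; rewrite ?andbF ?orbF //=.
case: (j =P i) => [->|/eqP ji]; last first.
  by rewrite -val_eqE in ji; rewrite (negPf ji) andbF !orbF.
by rewrite -vr rankK !ltnn eqxx; case: (tnth _ _).
Qed.

Lemma hdrs_next r : hdrs r 4 = hdrs r.+1 0.
Proof.
by apply: eq_hdr => v j; rewrite /hdrs ltn_ord ltnS andbT andbF orbF orbC -leq_eqVlt.
Qed.

Lemma hdrs_none : hdrs 0 0 = fun _ _ => false.
Proof. by apply: eq_hdr => v j; rewrite /hdrs !ltn0 !andbF. Qed.

Lemma hdrs_all : hdrs n 0 = fun v => tnth (hdr v).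
Proof. by apply: eq_hdr => v j; rewrite /hdrs rank_lt andbT. Qed.

Lemma inbox_none L v : inbox (fun _ _ _ => false) L v = finset.set0.
Proof.
apply/setP => -[j|[[[] k] l]]; rewrite !inE //.
by apply/existsP => -[u]; rewrite andbF.
Qed.

Lemma outbox_none L v : outbox (fun _ _ => false) (fun _ _ _ => false) L v = finset.set0.
Proof.
apply/setP => -[j|[[[] k] l]]; rewrite !inE //.
by apply/existsP => -[u]; rewrite andbF.
Qed.

Lemma boxE L v : inbox bit L v :|: outbox (fun v => tnth (hdr v)) bit L v = box hdr bit L v.
Proof. by apply/setP => -[j|[[[] k] l]]; rewrite !inE //= orbF. Qed.

(** * The phases of a round and their cost *)

Definition cf (q : sim_state U) p0 c1 p1 c2 p2 : aconfig U :=
  (q, (input U w, p0), (lay c1 n, p1), (lay c2 n, p2)).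

Lemma aupd_keep (f : nat -> tape_symbol (cell U)) p a m : a = f p ->
  aupd (f, p) (a, m) = amove (f, p) m.
Proof. by move=> ->; apply: aupd_same. Qed.

Lemma aupd_lay c c' j x m : j < n -> (forall i, i < n -> c' i = if i == j then x else c i) ->
  aupd (lay c n, j.+1) (Some (inr x) : tape_symbol (cell U), m) = amove (lay c' n, j.+1) m.
Proof. by move=> jn cc; rewrite /aupd (awrite_lay jn cc). Qed.

Let q0 (p : control) g : sim_state U := (p, Some g, finset.set0).

Lemma row_pos_lt r i : r < n -> i < 4 + (n + n) -> row_pos r + i < size w.
Proof. by move=> rn ib; rewrite size_word /row_pos; nia. Qed.

Lemma header_step r (i : 'I_4) g L D : r < n ->
  astep (cf (q0 (Header i) g) (row_pos r + i).+1
    (cell1 D L) 1 (cell2 (hdrs r i) D L) r.+1) =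
  cf (q0 (if i < 3 then Header (inord i.+1) else Row false) g) (row_pos r + i.+1).+1
    (cell1 D L) 1 (cell2 (hdrs r i.+1) D L) r.+1.
Proof.
move=> rn; have iw : row_pos r + i < size w by rewrite row_pos_lt // ltn_addr.
have s0 := input_nth U iw; rewrite (word_hdr _ rn) in s0.
have s2 := lay_cell (cell2 (hdrs r i) D L) n r; rewrite rn in s2.
rewrite /astep /= /scan /= s0 s2 /= (aupd_keep _ (esym s0)) aupd_keep //.
rewrite (@aupd_lay _ (cell2 (hdrs r i.+1) D L)) //= ?addnS // => j jn.
by rewrite hdrs_step // cell2_add_hdr.
Qed.

Lemma header_run r g L D : r < n ->
  run 4 (cf (q0 (Header ord0) g) (row_pos r).+1 (cell1 D L) 1 (cell2 (hdrs r 0) D L) r.+1)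
    (cf (q0 (Row false) g) (row_pos r + 4).+1 (cell1 D L) 1
      (cell2 (hdrs r.+1 0) D L) r.+1).
Proof.
move=> rn; pose c m := cf (q0 (if m < 4 then Header (inord m) else Row false) g)
  (row_pos r + m).+1 (cell1 D L) 1 (cell2 (hdrs r m) D L) r.+1.
have := @run_loop U 1 4 c; rewrite /c /= hdrs_next addn0 muln1.
have -> : inord 0 = ord0 :> 'I_4 by apply/val_inj; rewrite /= inordK.
apply=> i i4; apply: run_step; rewrite i4.
by have := @header_step r (inord i) g L D rn; rewrite inordK // => ->.
Qed.

Lemma row_step r k c g L H : r < n -> c < n ->
  astep (cf (q0 (Row k) g) (row_pos r + (4 + k * n + c)).+1
    (cell1 (arcs r k c) L) c.+1 (cell2 H (arcs r k c) L) r.+1) =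
  cf (q0 (Row k) g) (row_pos r + (4 + k * n + c.+1)).+1
    (cell1 (arcs r k c.+1) L) c.+2 (cell2 H (arcs r k c.+1) L) r.+1.
Proof.
move=> rn cn; have iw : row_pos r + (4 + k * n + c) < size w.
  by rewrite row_pos_lt //; case: k; lia.
have s0 := input_nth U iw; rewrite (word_bit _ rn cn) in s0.
have s1 := lay_cell (cell1 (arcs r k c) L) n c; rewrite cn in s1.
have s2 := lay_cell (cell2 H (arcs r k c) L) n r; rewrite rn in s2.
rewrite /astep /= /scan /= s0 s1 s2 /= (aupd_keep _ (esym s0)).
rewrite (@aupd_lay _ (cell1 (arcs r k c.+1) L)) //= => [|j jn]; last first.
  by rewrite arcs_step // cell1_add.
rewrite (@aupd_lay _ (cell2 H (arcs r k c.+1) L)) //= => [|j jn]; last first.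
  by rewrite arcs_step // cell2_add.
by rewrite /cf !addnS.
Qed.

Lemma back_run k g p0 c1 c2 p2 :
  run (n * 1) (cf (q0 (Back k) g) p0 c1 n c2 p2) (cf (q0 (Back k) g) p0 c1 0 c2 p2).
Proof.
have := @run_loop U 1 n (fun m => cf (q0 (Back k) g) p0 c1 (n - m) c2 p2).
rewrite subn0 subnn; apply=> i ilt; apply: run_step.
case e: (n - i) => [|j]; first by lia.
have jn : j < n by lia.
have s1 := lay_cell c1 n j; rewrite jn in s1.
rewrite /astep /= /scan /= s1 /= !aupd_keep //= -?s1 //.
by have -> : n - i.+1 = j by lia.
Qed.

(** The cost is [n] for the row, [n] for the way back and one step for each change of control. The
    head of tape 2 passes to the next vertex only after the second row, whence [r + k]. *)
Lemma row_run r (k : bool) g L H : r < n ->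
  let p0 := (row_pos r + (4 + k * n)).+1 in
  run (n + n + 2) (cf (q0 (Row k) g) p0
      (cell1 (arcs r k 0) L) 1 (cell2 H (arcs r k 0) L) r.+1)
    (cf (q0 (if k then Header ord0 else Row true) g) (p0 + n)
      (cell1 (arcs r k n) L) 1 (cell2 H (arcs r k n) L) (r + k).+1).
Proof.
move=> rn p0.
pose c m := cf (q0 (Row k) g) (row_pos r + (4 + k * n + m)).+1
  (cell1 (arcs r k m) L) m.+1 (cell2 H (arcs r k m) L) r.+1.
have R1 : run (n * 1) (c 0) (c n).
  by apply: run_loop => i ilt; apply: run_step; apply: row_step.
have R2 : run 1 (c n) (cf (q0 (Back k) g) (p0 + n)
    (cell1 (arcs r k n) L) n (cell2 H (arcs r k n) L) r.+1).
  have s1 := lay_cell (cell1 (arcs r k n) L) n n; rewrite ltnn in s1.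
  have -> : p0 + n = (row_pos r + (4 + k * n + n)).+1 by rewrite /p0; lia.
  apply: run_step; rewrite /c /astep /= /scan /= s1.
  (* The input symbol behind a row is a further bit or the final blank; the blank on tape 1 decides
     alone. *)
  by case s0: (input _ _ _) => [[x|x]|]; rewrite !aupd_keep.
have R3 := back_run k g (p0 + n) (cell1 (arcs r k n) L) (cell2 H (arcs r k n) L) r.+1.
have R4 : run 1 (cf (q0 (Back k) g) (p0 + n)
      (cell1 (arcs r k n) L) 0 (cell2 H (arcs r k n) L) r.+1)
    (cf (q0 (if k then Header ord0 else Row true) g) (p0 + n)
      (cell1 (arcs r k n) L) 1 (cell2 H (arcs r k n) L) (r + k).+1).
  apply: run_step; rewrite /astep /= /scan /=.
  by case: k @p0 c R1 R2 R3 => * /=; rewrite !aupd_keep ?addn1 ?addn0.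
have := run_trans (run_trans (run_trans R1 R2) R3) R4.
rewrite /c addn0 -/p0; apply: run_leq; lia.
Qed.

Let at_row g L r := cf (q0 (Header ord0) g) (row_pos r).+1
  (cell1 (arcs r false 0) L) 1 (cell2 (hdrs r 0) (arcs r false 0) L) r.+1.

Lemma block_run g L r : r < n -> run (n * 4 + 8) (at_row g L r) (at_row g L r.+1).
Proof.
move=> rn; have R1 := header_run g L (arcs r false 0) rn.
have R2 := row_run false g L (hdrs r.+1 0) rn.
have R3 := row_run true g L (hdrs r.+1 0) rn.
move: R2 R3; rewrite arcs_turn arcs_next mul0n mul1n !addn0 addn1 /=.
have -> : (row_pos r + 4).+1 + n = (row_pos r + (4 + n)).+1 by lia.
have -> : (row_pos r + (4 + n)).+1 + n = (row_pos r.+1).+1 by rewrite /row_pos; lia.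
move=> R2 R3; apply: run_leq (run_trans (run_trans R1 R2) R3); lia.
Qed.

Lemma rows_run g L : run (n * (n * 4 + 8)) (at_row g L 0) (at_row g L n).
Proof. by apply: run_loop => r rn; apply: block_run. Qed.

Lemma rewind_run g L : run (size w + 2) (at_row g L n)
  (cf (Sweep, Some g, finset.set0) 1 (cell1 bit L) 1
    (cell2 (fun v => tnth (hdr v)) bit L) 1).
Proof.
rewrite /at_row arcs_all hdrs_all; set c1 := cell1 _ _; set c2 := cell2 _ _ _.
(* Truncated subtraction in [n - m] expresses that the head of tape 2 waits on cell 0. *)
pose c m := cf (q0 Rewind g) (size w - m) c1 0 c2 (n - m).
have R1 : run 1 (cf (q0 (Header ord0) g) (row_pos n).+1 c1 1 c2 n.+1) (c 0).
  rewrite /c !subn0 size_word; apply: run_step.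
  have s0 : input U w (row_pos n).+1 = None by rewrite input_end // size_word.
  by rewrite /astep /= /scan /= s0 /= !aupd_keep.
have R2 : run (size w * 1) (c 0) (c (size w)).
  apply: run_loop => i iw; apply: run_step; rewrite /c.
  case e: (size w - i) => [|j]; first by lia.
  have jw : j < size w by lia.
  have s0 := input_nth U jw.
  rewrite /astep /= /scan /= s0 /= !aupd_keep //.
  have -> : size w - i.+1 = j by lia.
  case e2: (n - i) => [|k].
    by have -> : n - i.+1 = 0 by lia.
  have kn : k < n by lia.
  have -> : n - i.+1 = k by lia.
  by rewrite lay_cell kn.
have R3 : run 1 (c (size w)) (cf (Sweep, Some g, finset.set0) 1 c1 1 c2 1).
  rewrite /c subnn; have -> : n - size w = 0 by rewrite size_word /row_pos; lia.
  by apply: run_step; rewrite /astep /= /scan /= !aupd_keep.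
apply: run_leq (run_trans (run_trans R1 R2) R3); lia.
Qed.

Let fresh L i : cell U := (L (vtx i), finset.set0).

(** The reference point between rounds: the global state has just advanced, the verdict is looked
    up, and cell [n.+3] holds the first bit behind the player bit. *)
Definition round_start g L : aconfig U := cf (q0 Home g) n.+3 (fresh L) n (fresh L) n.

Lemma home_run g L : out g = None -> run (n + 1) (round_start g L) (at_row g L 0).
Proof.
move=> og; pose c m := cf (q0 Home g) n.+3 (fresh L) (n - m) (fresh L) (n - m).
have R1 : run (n * 1) (round_start g L) (c n).
  have -> : round_start g L = c 0 by rewrite /c subn0.
  apply: run_loop => i ilt; apply: run_step; rewrite /c.
  case e: (n - i) => [|j]; first by lia.
  have jn : j < n by lia.
  have -> : n - i.+1 = j by lia.
  by rewrite /astep /= og /scan /= lay_cell jn /= !aupd_keep // lay_cell jn.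
have R2 : run 1 (c n) (at_row g L 0).
  rewrite /c subnn; apply: run_step; rewrite /astep /= og /scan /= !aupd_keep //.
  rewrite /at_row /cf arcs_none hdrs_none /row_pos mul0n addn0.
  congr (_, _, _, (_, _), (_, _)); apply: lay_ext => i _.
    by rewrite /cell1 inbox_none.
  by rewrite /cell2 outbox_none.
apply: run_leq (run_trans R1 R2); lia.
Qed.

Lemma word_size_gt : n.+1 < size w.
Proof. by rewrite size_word /row_pos; lia. Qed.

Lemma sweep_end (g : option (glob U)) (s : {set lab U}) c1 c2 : run 2
  (cf (Sweep, g, s) n.+1 c1 n.+1 c2 n.+1)
  (cf (q0 Home (if g is Some g' then advance g' s else glob0 U b)) n.+3 c1 n c2 n).
Proof.
have s0 := input_nth U (ltnW word_size_gt); rewrite word_sep in s0.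
have s0' := input_nth U word_size_gt; rewrite word_player in s0'.
apply: (@run_trans _ 1 1 _ (cf (Player, g, s) n.+2 c1 n c2 n)); apply: run_step.
  by rewrite /astep /= /scan /= s0 /= !aupd_keep.
by rewrite /astep /= /scan /= s0' /= !aupd_keep //=; case: b.
Qed.

(** The update is synchronous although the sweep is sequential, because the mailboxes were filled
    from the old labels in the preceding pass. *)
Lemma sweep_run g L :
  run (n + 2) (cf (Sweep, Some g, finset.set0) 1 (cell1 bit L) 1
      (cell2 (fun v => tnth (hdr v)) bit L) 1)
    (round_start (advance g [set relabel hdr bit g L v | v : V]) (relabel hdr bit g L)).
Proof.
set L' := relabel hdr bit g L; set c1 := cell1 _ _; set c2 := cell2 _ _ _.
pose S m := [set l : lab U | l \in [seq L' (vtx i) | i <- iota 0 m]].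
pose mix (c0 : nat -> cell U) m i := if i < m then fresh L' i else c0 i.
pose c m := cf (Sweep, Some g, S m) m.+1 (mix c1 m) m.+1 (mix c2 m) m.+1.
have R1 : run (n * 1) (c 0) (c n).
  apply: run_loop => i ilt; apply: run_step; rewrite /c.
  have s0 := input_nth U (leq_trans ilt (ltnW (ltnW word_size_gt))).
  rewrite (word_one ilt) in s0.
  have mixS c0 j : j < n -> mix c0 i.+1 j =
      if j == i then (L' (vtx i), finset.set0) else mix c0 i j.
    rewrite /mix ltnS => jn; rewrite leq_eqVlt.
    by case: (j =P i) => [->|_] /=.
  have s1 := lay_cell (mix c1 i) n i; have s2 := lay_cell (mix c2 i) n i.
  rewrite ilt /mix ltnn -/(mix _ _) in s1 s2.
  rewrite /astep /= /scan /= s0 s1 s2 /= boxE (aupd_keep _ (esym s0)).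
  rewrite (aupd_lay _ ilt (mixS c1)) (aupd_lay _ ilt (mixS c2)) /=.
  congr (_, _, _, _, _, _); apply/setP => l.
  have iotaS : iota 0 i.+1 = rcons (iota 0 i) i by rewrite -addn1 iotaD cats1.
  rewrite finset.in_setU1 !finset.in_set iotaS.
  by rewrite map_rcons mem_rcons !inE.
have c0E : c 0 = cf (Sweep, Some g, finset.set0) 1 c1 1 c2 1.
  by congr (_, _, _, _, _, _); apply/setP => l; rewrite !inE.
have SE : S n = [set L' v | v : V].
  apply/setP => l; rewrite inE; apply/mapP/imsetP => [[i _ ->]|[v _ ->]].
    by exists (vtx i).
  by exists (rank v); rewrite ?rankK // mem_iota rank_lt.
have fr c0 : lay (mix c0 n) n = lay (fresh L') n.
  by apply: lay_ext => i ilt; rewrite /mix ilt.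
have R2 : run 2 (c n) (round_start (advance g [set L' v | v : V]) L').
  by rewrite /c SE /cf !fr; apply: (sweep_end (Some g) _ (fresh L') (fresh L')).
rewrite -c0E; apply: run_leq (run_trans R1 R2); lia.
Qed.

(** On blank tapes the default branch of [Sweep] writes [lab0] into fresh cells; without a previous
    global state, the player bit selects [glob0]. *)
Lemma setup_run : run (n + 2) (start_aconfig U w) (round_start (glob0 U b) (fun=> lab0 U)).
Proof.
pose L0 (_ : V) := lab0 U; pose S m := iter m (fun s => lab0 U |: s) finset.set0.
pose c m : aconfig U := ((Sweep, None, S m), (input U w, m.+1),
  (lay (fresh L0) m, m.+1), (lay (fresh L0) m, m.+1)).
have R1 : run (n * 1) (c 0) (c n).
  apply: run_loop => i ilt; apply: run_step; rewrite /c.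
  have s0 := input_nth U (leq_trans ilt (ltnW (ltnW word_size_gt))).
  rewrite (word_one ilt) in s0.
  have s1 := lay_cell (fresh L0) i i; rewrite ltnn in s1.
  have wr : aupd (lay (fresh L0) i, i.+1) (Some (inr (lab0 U, finset.set0)), MoveRight) =
      (lay (fresh L0) i.+1, i.+2).
    rewrite /aupd /awrite /=; congr (_, _); apply/funext => -[|j] //=.
    rewrite !lay_cell eqSS ltnS [j <= i]leq_eqVlt.
    by case: (j =P i) => [->|_] /=.
  by rewrite /astep /= /scan /= s0 s1 /= (aupd_keep _ (esym s0)) wr.
have c0E : c 0 = start_aconfig U w.
  by rewrite /c /start_aconfig; have -> : lay (fresh L0) 0 = fun=> None
    by apply/funext => -[|i]; rewrite ?lay_cell.
rewrite -c0E; apply: run_leq (run_trans R1 (sweep_end None (S n) (fresh L0) (fresh L0))).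
lia.
Qed.

(** Since [size w = 2n^2 + 5n + 2], the phases add up to [3 * size w + 1] steps; the bound is a
    generous rounding. *)
Definition round_cost := 5 * size w + 10.

Lemma round_run g L : out g = None -> run round_cost (round_start g L)
  (round_start (advance g [set relabel hdr bit g L v | v : V]) (relabel hdr bit g L)).
Proof.
move=> og; have := run_trans (run_trans (run_trans (home_run L og) (rows_run g L))
  (rewind_run g L)) (sweep_run g L).
apply: run_leq; rewrite /round_cost size_word /row_pos; nia.
Qed.

(** The additional round in [t.+1] pays for the setup sweep. *)
Theorem simulator_correct t g L a : iter t (gstep hdr bit) (gstart U V b) = (g, L) ->
  out g = Some a -> answers_within (simulator U) w (t.+1 * round_cost) a.
Proof.
suff R : iter t (gstep hdr bit) (gstart U V b) = (g, L) ->
    run (t.+1 * round_cost) (start_aconfig U w) (round_start g L).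
  by move=> /R r oa; exact: answers_run r oa.
elim: t g L => [|t IH] g L /=.
  case=> <- <-; apply: run_leq setup_run.
  by have := word_size_gt; rewrite /round_cost; lia.
case: (iter t _ _) IH => g' L' /(_ g' L' erefl) IH; rewrite /gstep /=.
case og: (out g') => [a'|] [<- <-].
  by apply: run_leq IH; rewrite leq_mul2r leqnSn orbT.
by rewrite [t.+2 * _]mulSnr; apply: run_trans IH (round_run _ og).
Qed.

End Rounds.

(** * The decision procedure as a graph automaton *)

(* [l_layer] and [l_attr] hold the current layer set and its attractor, [l_layer0]
   and [l_attr0] those of the last level from which C can be avoided; [l_fix] and
   [l_premise] hold the fixpoints for losing walks and for condition (1). *)
Record label := Label {
  l_own : bool; l_target : bool; l_init : bool; l_set : bool;
  l_layer : bool; l_attr : bool; l_layer0 : bool; l_attr0 : bool;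
  l_fix : bool; l_premise : bool; l_changed : bool
}.

Definition label_code (l : label) :=
  let: Label a b c d e f g h i j k := l in (a, b, c, d, e, f, g, h, i, j, k).
Definition label_decode x :=
  let: (a, b, c, d, e, f, g, h, i, j, k) := x in Label a b c d e f g h i j k.
Lemma label_codeK : cancel label_code label_decode. Proof. by case. Qed.
HB.instance Definition _ := Finite.copy label (can_type label_codeK).

(* The argument of [Losing] tells the final pass, in the game restricted to the
   best level, from the first one, in the game restricted to the given strategy;
   that of [Attract] whether an avoidable level has been found. *)
Inductive phase :=
  Setup | Save | Premise | Losing of bool | Attract of bool | Done of bool.

Definition phase_code (p : phase) : bool + bool + bool + option bool :=
  match p with
  | Setup => inr None
  | Save => inr (Some true)
  | Premise => inr (Some false)
  | Losing f => inl (inl (inl f))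
  | Attract f => inl (inl (inr f))
  | Done f => inl (inr f)
  end.
Definition phase_decode (x : bool + bool + bool + option bool) : phase :=
  match x with
  | inr None => Setup
  | inr (Some true) => Save
  | inr (Some false) => Premise
  | inl (inl (inl f)) => Losing f
  | inl (inl (inr f)) => Attract f
  | inl (inr f) => Done f
  end.
Lemma phase_codeK : cancel phase_code phase_decode. Proof. by case. Qed.
HB.instance Definition _ := Finite.copy phase (can_type phase_codeK).

Definition some_message (M : {set message label}) (d k : bool) (q : pred label) : bool :=
  [exists l, (inr (d, k, l) \in M) && q l].

Definition header (M : {set message label}) (i : 'I_4) : bool := inl i \in M.

Definition check_upd (g : bool * phase) (l : label) (M : {set message label}) : label :=
  let: (reach, ph) := g in
  let: Label own target init_ set_ layer attr layer0 attr0 fix_ premise _ := l in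
  let some_succ frozen := some_message M true (own && frozen) in
  match ph with
  | Setup =>
    let reachv := header M ord0 in
    let safev := header M (Ordinal (isT : 1 < 4)) in
    Label (if reach then reachv else safev) (~~ reachv && ~~ safev)
      (header M (Ordinal (isT : 2 < 4))) (header M (Ordinal (isT : 3 < 4)))
      (* [layer0] starts full and [attr0] empty, so that the first losing pass takes place in the
         graph of [sigma]. *)
      false false true false false false false
  | Losing _ =>
    let succ_in q := ~~ attr0 && some_succ layer0 (fun l' => ~~ l_attr0 l' && q l') in
    let new := if reach then ~~ succ_in (fun l' => ~~ l_fix l')
               else target || succ_in l_fix in
    Label own target init_ set_ layer attr layer0 attr0 new premise (new (+) fix_)
  | Premise =>
    (* Infinite walks form a greatest fixpoint, so for Reach the least fixpoint in [fix_] is the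
       complement of the losing set; the exclusive or corrects for this. *)
    let new := set_ && (fix_ (+) reach) || some_succ true l_premise in
    Label own target init_ set_ layer attr layer0 attr0 fix_ new (new (+) premise)
  | Attract _ =>
    let new := set_ || (if own then ~~ some_succ layer (fun l' => ~~ l_attr l')
                        else some_succ layer l_attr) in
    Label own target init_ set_ layer new layer0 attr0 fix_ premise (new (+) attr)
  | Save =>
    let new := [|| init_, some_message M false true (fun l' => l_own l' && l_layer l')
                 | some_message M false false (fun l' => ~~ l_own l' && l_layer l')] in
    Label own target init_ set_ new false layer attr false premise (new (+) layer)
  | Done _ => l
  end.

Definition check_advance (g : bool * phase) (S : {set label}) : bool * phase :=
  let: (reach, ph) := g in
  let changed := [exists l in S, l_changed l] in
  let at_init q := [exists l in S, l_init l && q l] in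
  (reach,
    match ph with
    | Setup => Losing false
    | Losing f => if changed then ph
                  else if f then Done (~~ at_init (fun l => l_fix l (+) reach)) else Premise
    | Premise => if changed then ph
                 else if at_init l_premise then Attract false else Done false
    | Attract f => if changed then ph
                   else if at_init l_attr then (if f then Losing true else Done false)
                   else Save
    | Save => if changed then Attract true else Done false
    | Done _ => ph
    end).

Definition checker : automaton :=
  {| glob := (bool * phase)%type;
     lab := label;
     lab0 := Label false false false false false false false false false false false;
     glob0 := fun reach => (reach, Setup);
     upd := check_upd;
     advance := check_advance;
     out := fun g => if g.2 is Done answer then Some answer else None |}.

Section Checker.
Variables (G : game) (P : player) (sigma : strategy G P) (C : {set G}).
Implicit Types (X Y Z A Q : {set G}) (v : G).

Definition vertex_header v : 4.-tuple bool :=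
  [tuple controls Reach v; controls Safe v; v == init G; v \in C].

Definition vertex_bit (k : bool) : rel G := fun v w =>
  if k then controls P v && (sigma v == w) else edge v w.

Let reach := P == Reach.
Let cstep := @gstep checker G vertex_header vertex_bit.

(** Seven sets of vertices represent the mutable part of all labels, which turns rounds into set
    operators. *)
Definition labelling Q A Q0 A0 X Y Z : G -> label := fun v =>
  Label (controls P v) (v \in targets G) (v == init G) (v \in C)
    (v \in Q) (v \in A) (v \in Q0) (v \in A0) (v \in X) (v \in Y) (v \in Z).

Lemma some_messageE (L : G -> label) (v : G) (d k : bool) (q : pred label) :
  some_message (@box checker G vertex_header vertex_bit L v) d k q =
  [exists w, (if d then vertex_bit k v w else vertex_bit k w v) && q (L w)].
Proof.
apply/existsP/existsP => [[l]|[w /andP[vw qw]]].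
  rewrite inE => /andP[/existsP[w /andP[/eqP<- vw]] ql].
  by exists w; rewrite vw.
by exists (L w); rewrite inE qw andbT; apply/existsP; exists w; rewrite eqxx.
Qed.

Lemma frozen_bit Q v w :
  vertex_bit (controls P v && (v \in Q)) v w = fedge sigma Q v w.
Proof.
rewrite /vertex_bit /fedge andbC; case: ifP => [/andP[vQ cv]|]; rewrite ?andbT //.
rewrite cv eq_sym /=; case: eqP => [->|]; last by rewrite andbF.
by rewrite choice_edge.
Qed.

Lemma some_succE (L : G -> label) Q v (q : pred label) :
  some_message (@box checker G vertex_header vertex_bit L v) true
    (controls P v && (v \in Q)) q = [exists w, fedge sigma Q v w && q (L w)].
Proof.
by rewrite some_messageE; apply: eq_existsb => w; rewrite frozen_bit.
Qed.

(** * Rounds of the automaton as operators on sets *)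

Definition losing_step Q0 A0 X : {set G} :=
  if reach then wpre (hedge sigma Q0 A0) X
  else targets G :|: pre (hedge sigma Q0 A0) X.

Definition losing_set X : {set G} := if reach then ~: X else X.

Definition premise_step X Y : {set G} := (C :&: losing_set X) :|: pre (sedge sigma) Y.

Definition layer_step Q : {set G} := init G |: post (sedge sigma) Q.

Definition symdiff X Y : {set G} := [set v | (v \in X) (+) (v \in Y)].

Lemma losing_setE X v : (v \in losing_set X) = (v \in X) (+) reach.
Proof. by rewrite /losing_set; case: reach; rewrite ?inE ?addbT ?addbF. Qed.

Lemma sedgeE v w : sedge sigma v w = fedge sigma [set: G] v w.
Proof. by rewrite /sedge /fedge inE. Qed.

Lemma hedge_full v w : hedge sigma [set: G] finset.set0 v w = sedge sigma v w.
Proof. by rewrite /hedge !inE !andbT sedgeE. Qed.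

Let relab ph := @relabel checker G vertex_header vertex_bit (reach, ph).

Lemma relab_setup L : relab Setup L =
  labelling finset.set0 finset.set0 [set: G] finset.set0 finset.set0 finset.set0 finset.set0.
Proof.
apply/funext => v; rewrite /relab /relabel /= /check_upd; case: (L v) => *.
rewrite /labelling !inE /header !inE !(tnth_nth false) /=; congr Label.
  by rewrite /reach; case: P.
by rewrite /controls; case: (owner v) => [[]|].
Qed.

Lemma relab_losing f Q A Q0 A0 X Y Z :
  relab (Losing f) (labelling Q A Q0 A0 X Y Z) =
  labelling Q A Q0 A0 (losing_step Q0 A0 X) Y (symdiff (losing_step Q0 A0 X) X).
Proof.
apply/funext => v; rewrite /relab /relabel /= !some_succE /labelling /=.
have succE (q : pred G) : (v \notin A0) &&
    [exists w, fedge sigma Q0 v w && ((w \notin A0) && q w)] =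
    [exists w, hedge sigma Q0 A0 v w && q w].
  rewrite /hedge; have [vA|vA] /= := boolP (v \in A0); apply/esym.
    by apply/existsP => -[w]; rewrite andbF.
  by apply: eq_existsb => w; rewrite -andbA.
have -> : (if reach then ~~ ((v \notin A0) &&
      [exists w, fedge sigma Q0 v w && ((w \notin A0) && (w \notin X))])
    else (v \in targets G) || (v \notin A0) &&
      [exists w, fedge sigma Q0 v w && ((w \notin A0) && (w \in X))]) =
    (v \in losing_step Q0 A0 X).
  rewrite !succE /losing_step; case: reach; rewrite !inE //.
  rewrite negb_exists; apply: eq_forallb => w.
  by rewrite negb_and negbK implybE.
by rewrite [v \in symdiff _ _]inE.
Qed.

Lemma relab_premise Q A Q0 A0 X Y Z :
  relab Premise (labelling Q A Q0 A0 X Y Z) =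
  labelling Q A Q0 A0 X (premise_step X Y) (symdiff (premise_step X Y) Y).
Proof.
apply/funext => v; rewrite /relab /relabel /= /labelling.
have -> : controls P v && true = controls P v && (v \in [set: G]) by rewrite inE.
rewrite some_succE /=.
have -> : (v \in C) && ((v \in X) (+) reach) ||
    [exists w, fedge sigma [set: G] v w && (w \in Y)] = (v \in premise_step X Y).
  rewrite !inE losing_setE; congr (_ || _).
  by apply: eq_existsb => w; rewrite sedgeE.
by rewrite !inE.
Qed.

Lemma relab_attract f Q A Q0 A0 X Y Z :
  relab (Attract f) (labelling Q A Q0 A0 X Y Z) =
  labelling Q (attractor_step sigma C Q A) Q0 A0 X Y
    (symdiff (attractor_step sigma C Q A) A).
Proof.
apply/funext => v; rewrite /relab /relabel /= /labelling !some_succE /=.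
have -> : (v \in C) || (if controls P v
      then ~~ [exists w, fedge sigma Q v w && (w \notin A)]
      else [exists w, fedge sigma Q v w && (w \in A)]) =
    (v \in attractor_step sigma C Q A).
  rewrite !inE; congr (_ || _); case: ifP => // _; rewrite negb_exists.
  by apply: eq_forallb => w; rewrite negb_and negbK implybE.
by rewrite !inE.
Qed.

Lemma relab_save Q A Q0 A0 X Y Z :
  relab Save (labelling Q A Q0 A0 X Y Z) =
  labelling (layer_step Q) finset.set0 Q A finset.set0 Y (symdiff (layer_step Q) Q).
Proof.
apply/funext => v; rewrite /relab /relabel /= /labelling !some_messageE /=.
have -> : [|| v == init G,
      [exists w, controls P w && (sigma w == v) && (controls P w && (w \in Q))]
    | [exists w, edge w v && (~~ controls P w && (w \in Q))]] = (v \in layer_step Q).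
  rewrite !inE; congr (_ || _); apply/orP/existsP.
    case=> /existsP[w].
      move=> /andP[/andP[cw /eqP<-] /andP[_ wQ]]; exists w.
      by rewrite wQ /sedge choice_edge // eqxx implybT.
    by move=> /andP[wv /andP[cw wQ]]; exists w; rewrite wQ /sedge wv (negPf cw).
  case=> w /andP[/andP[wv cw] wQ]; have [cP|cP] := boolP (controls P w).
    left; apply/existsP; exists w.
    by rewrite cP wQ !andbT eq_sym; move: cw; rewrite cP.
  by right; apply/existsP; exists w; rewrite wv cP.
by rewrite !inE.
Qed.

Lemma exists_changed Q A Q0 A0 X Y (X1 X2 : {set G}) :
  [exists l in [set labelling Q A Q0 A0 X Y (symdiff X1 X2) v | v : G], l_changed l] =
  (X1 != X2).
Proof.
apply/idP/idP => [/existsP[l /andP[/imsetP[v _ ->]] /=]|].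
  by apply: contraTneq => ->; rewrite inE addbb.
apply: contraR => /existsPn nex; apply/eqP/setP => v.
have := nex (labelling Q A Q0 A0 X Y (symdiff X1 X2) v).
by rewrite imset_f //= inE; case: (_ \in _); case: (_ \in _).
Qed.

Lemma exists_init Q A Q0 A0 X Y Z (q : pred label) :
  [exists l in [set labelling Q A Q0 A0 X Y Z v | v : G], l_init l && q l] =
  q (labelling Q A Q0 A0 X Y Z (init G)).
Proof.
apply/existsP/idP => [[l /andP[/imsetP[v _ ->]] /= /andP[/eqP-> //]]|qi].
by exists (labelling Q A Q0 A0 X Y Z (init G)); rewrite imset_f //= eqxx.
Qed.

Definition config_of ph Q A Q0 A0 X Y Z : (bool * phase) * (G -> label) :=
  ((reach, ph), labelling Q A Q0 A0 X Y Z).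

Lemma cstepE ph L L' : (forall answer, ph <> Done answer) -> relab ph L = L' ->
  cstep ((reach, ph), L) = (check_advance (reach, ph) [set L' v | v : G], L').
Proof. by move=> nd <-; case: ph nd => [||?|?|?|a /(_ a)]. Qed.

Lemma cstep_setup L : cstep ((reach, Setup), L) =
  config_of (Losing false) finset.set0 finset.set0 [set: G] finset.set0
    finset.set0 finset.set0 finset.set0.
Proof. by rewrite (cstepE _ (relab_setup L)). Qed.

Lemma symdiffv X : symdiff X X = finset.set0.
Proof. by apply/setP => v; rewrite !inE addbb. Qed.

Lemma cstep_losing f Q A Q0 A0 X Y Z :
  let X' := losing_step Q0 A0 X in
  cstep (config_of (Losing f) Q A Q0 A0 X Y Z) =
  if X' == X then config_of (if f then Done (init G \notin losing_set X) else Premise)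
                    Q A Q0 A0 X Y finset.set0
  else config_of (Losing f) Q A Q0 A0 X' Y (symdiff X' X).
Proof.
move=> X'; rewrite (cstepE _ (relab_losing f Q A Q0 A0 X Y Z)) // -/X' /=.
rewrite exists_changed exists_init /=; case: eqP => [->|_] //.
by rewrite symdiffv losing_setE.
Qed.

Lemma cstep_premise Q A Q0 A0 X Y Z :
  let Y' := premise_step X Y in
  cstep (config_of Premise Q A Q0 A0 X Y Z) =
  if Y' == Y then config_of (if init G \in Y then Attract false else Done false)
                    Q A Q0 A0 X Y finset.set0
  else config_of Premise Q A Q0 A0 X Y' (symdiff Y' Y).
Proof.
move=> Y'; rewrite (cstepE _ (relab_premise Q A Q0 A0 X Y Z)) // -/Y' /=.
rewrite exists_changed exists_init /=; case: eqP => [->|_] //.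
by rewrite symdiffv.
Qed.

Lemma cstep_attract f Q A Q0 A0 X Y Z :
  let A' := attractor_step sigma C Q A in
  cstep (config_of (Attract f) Q A Q0 A0 X Y Z) =
  if A' == A
  then config_of (if init G \in A then if f then Losing true else Done false else Save)
         Q A Q0 A0 X Y finset.set0
  else config_of (Attract f) Q A' Q0 A0 X Y (symdiff A' A).
Proof.
move=> A'; rewrite (cstepE _ (relab_attract f Q A Q0 A0 X Y Z)) // -/A' /=.
rewrite exists_changed exists_init /=; case: eqP => [->|_] //.
by rewrite symdiffv.
Qed.

Lemma cstep_save Q A Q0 A0 X Y Z :
  let Q' := layer_step Q in
  cstep (config_of Save Q A Q0 A0 X Y Z) =
  config_of (if Q' == Q then Done false else Attract true)
    Q' finset.set0 Q A finset.set0 Y (symdiff Q' Q).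
Proof.
move=> Q'; rewrite (cstepE _ (relab_save Q A Q0 A0 X Y Z)) // -/Q' /=.
by rewrite exists_changed; case: eqP.
Qed.

(** * Runs of the automaton and their length *)

Definition creach t c c' := exists2 t', t' <= t & iter t' cstep c = c'.

Lemma creach_trans t u c1 c2 c3 : creach t c1 c2 -> creach u c2 c3 -> creach (t + u) c1 c3.
Proof.
move=> [t' tt <-] [u' uu <-]; exists (u' + t'); first by rewrite addnC leq_add.
by rewrite iterD.
Qed.

Lemma creach_step c c' : cstep c = c' -> creach 1 c c'. Proof. by exists 1. Qed.

(** [K] is the configuration inside the loop and [E] the one after it. The loop is left at the first
    index where two successive iterates coincide, at most [#|G|], and that iterate is already the
    fixpoint; one more round detects the coincidence. *)
Lemma fixset_loop (F : {set G} -> {set G}) K E (Z : {set G}) :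
    {homo F : X Y / X \subset Y} ->
    (forall X Z, cstep (K X Z) = if F X == X then E X else K (F X) (symdiff (F X) X)) ->
  creach #|G|.+1 (K finset.set0 Z) (E (fixset F)).
Proof.
move=> mono step; have ex : exists i, iter i.+1 F finset.set0 == iter i F finset.set0.
  by exists #|G|; rewrite -[iter _ _ _]/(F (fixset F)) fixsetK.
have [i /eqP iF imin] := ex_minnP ex.
have in_ : i <= #|G| by apply: imin; rewrite -[iter _.+1 _ _]/(F (fixset F)) fixsetK.
have fixE : fixset F = iter i F finset.set0.
  by rewrite /fixset -(subnK in_) iterD iter_fix.
have chain j : j <= i -> exists Z', iter j cstep (K finset.set0 Z) = K (iter j F finset.set0) Z'.
  elim: j => [|j IH] ji; first by exists Z.
  have [Z' Zj] := IH (ltnW ji); rewrite iterS Zj step; case: eqP => [eq|_].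
    by have := imin j; rewrite leqNgt ji iterS eq eqxx => /(_ isT).
  by eexists.
have [Z' Zi] := chain i (leqnn i).
by exists i.+1; rewrite // iterS Zi step -iterS iF eqxx fixE.
Qed.

Lemma losing_step_mono Q0 A0 : {homo losing_step Q0 A0 : X Y / X \subset Y}.
Proof.
rewrite /losing_step => X Y XY; case: ifP => _; first exact: wpre_mono.
exact: (setU_mono (targets G) (@pre_mono _ (hedge sigma Q0 A0))).
Qed.

Lemma premise_step_mono X : {homo premise_step X : Y Z / Y \subset Z}.
Proof. exact: (setU_mono _ (@pre_mono _ _)). Qed.

Lemma layer_step_mono : {homo layer_step : X Y / X \subset Y}.
Proof. exact: (setU_mono _ (@post_mono _ _)). Qed.

Lemma losing_fixset Q0 A0 v : v \in losing_set (fixset (losing_step Q0 A0)) <->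
  losing_walk P (hedge sigma Q0 A0) v.
Proof.
rewrite /losing_set /losing_walk /losing_step -/reach; case: reach.
  exact: fixset_wpre.
by split=> /fixset_pre.
Qed.

Let X1 := fixset (losing_step [set: G] finset.set0).

Lemma premise_fixset : init G \in fixset (premise_step X1) <-> causal_premise sigma C.
Proof.
have full : hedge sigma [set: G] finset.set0 = sedge sigma.
  by apply/funext => v; apply/funext => u; rewrite hedge_full.
split=> [/fixset_pre[v]|[v vC [iv lw]]].
  rewrite inE => /andP[vC /losing_fixset lw] iv; exists v => //.
  by rewrite full in lw.
apply/fixset_pre; exists v => //; rewrite inE vC; apply/losing_fixset.
by rewrite full.
Qed.

Variable K : realType.
Let cause := counterfactual_cause (@d_pref_H K G P) sigma C.

Let decided t c := exists (answer : bool) L,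
  creach t c ((reach, Done answer), L) /\ (answer <-> cause).

Let decidedI t c (answer : bool) Q A Q0 A0 X Y Z :
  creach t c (config_of (Done answer) Q A Q0 A0 X Y Z) -> (answer <-> cause) ->
  decided t c.
Proof.
by move=> tc ac; exists answer, (labelling Q A Q0 A0 X Y Z).
Qed.

Lemma decided_trans t u c c' : creach t c c' -> decided u c' -> decided (t + u) c.
Proof.
move=> cc' [answer [L [c'a ac]]]; exists answer, L; split=> //.
exact: creach_trans cc' c'a.
Qed.

Lemma decided_leq t u c : t <= u -> decided t c -> decided u c.
Proof.
move=> tu [answer [L [[t' tt ca] ac]]]; exists answer, L; split=> //.
by exists t' => //; apply: leq_trans tu.
Qed.

Lemma attract_run k found Q0 A0 X Y Z : let Q := layers sigma k in
  let A := attractor sigma C Q in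
  creach #|G|.+1 (config_of (Attract found) Q finset.set0 Q0 A0 X Y Z)
    (config_of (if init G \in A then if found then Losing true else Done false else Save)
       Q A Q0 A0 X Y finset.set0).
Proof.
move=> Q A; apply: (@fixset_loop (attractor_step sigma C Q)
  (fun A Z => config_of (Attract found) Q A Q0 A0 X Y Z)
  (fun A => config_of (if init G \in A then if found then Losing true else Done false
                       else Save) Q A Q0 A0 X Y finset.set0)).
  exact: attractor_step_mono.
by move=> A' Z'; apply: cstep_attract.
Qed.

Lemma losing_run f Q A Q0 A0 Y Z : let X := fixset (losing_step Q0 A0) in
  creach #|G|.+1 (config_of (Losing f) Q A Q0 A0 finset.set0 Y Z)
    (config_of (if f then Done (init G \notin losing_set X) else Premise)
       Q A Q0 A0 X Y finset.set0).
Proof.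
apply: (@fixset_loop (losing_step Q0 A0) (fun X Z => config_of (Losing f) Q A Q0 A0 X Y Z)
  (fun X => config_of (if f then Done (init G \notin losing_set X) else Premise)
       Q A Q0 A0 X Y finset.set0)).
  exact: losing_step_mono.
by move=> X' Z'; apply: cstep_losing.
Qed.

Lemma premise_run Q A Q0 A0 X Z : let Y := fixset (premise_step X) in
  creach #|G|.+1 (config_of Premise Q A Q0 A0 X finset.set0 Z)
    (config_of (if init G \in Y then Attract false else Done false)
       Q A Q0 A0 X Y finset.set0).
Proof.
apply: (@fixset_loop (premise_step X) (fun Y Z => config_of Premise Q A Q0 A0 X Y Z)
  (fun Y => config_of (if init G \in Y then Attract false else Done false)
       Q A Q0 A0 X Y finset.set0)).
  exact: premise_step_mono.
by move=> Y' Z'; apply: cstep_premise.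
Qed.

(** [m] bounds the levels left, as layers are stationary from [#|G|] on. Each level costs [#|G|.+1]
    rounds for the attractor and one for [Save]; the [.+2] covers the attractor of the last level
    and the final losing pass. *)
Lemma attract_decided m k (found : bool) Q0 A0 X Y Z : k + m = #|G| ->
    causal_premise sigma C ->
    (if found then exists k', [/\ k = k'.+1, Q0 = layers sigma k',
       A0 = attractor sigma C Q0, init G \notin A0 & X = finset.set0]
     else k = 0) ->
  decided (m.+2 * (#|G| + 2))
    (config_of (Attract found) (layers sigma k) finset.set0 Q0 A0 X Y Z).
Proof.
elim/ltn_ind: m k found Q0 A0 X Y Z => m IH k found Q0 A0 X Y Z km prem inv.
have := attract_run k found Q0 A0 X Y Z; cbv zeta.
set A := attractor sigma C (layers sigma k) => R1.
have [iA|iA] := boolP (init G \in A).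
  rewrite iA in R1; case: found inv R1 => [[k' [kk' Q0E A0E iA0 XE]]|k0] R1.
    apply: (@decided_leq (#|G|.+1 + #|G|.+1)); first by nia.
    apply: decided_trans R1 _; rewrite XE.
    apply: decidedI (losing_run true _ _ _ _ _ _) _.
    have iA' : init G \in attractor sigma C (layers sigma k'.+1) by rewrite -kk'.
    rewrite Q0E in A0E; rewrite A0E in iA0.
    have cl := cause_level K prem iA0 iA'.
    rewrite Q0E A0E; split=> [/negP nl|/cl nl].
      by apply/cl => /losing_fixset.
    by apply/negP => /losing_fixset.
  apply: (@decided_leq #|G|.+1); first by nia.
  apply: decidedI R1 _; split=> // /cause_avoidable.
  by move: iA; rewrite /A k0 => ->.
rewrite (negPf iA) in R1.
have R2 := creach_step (cstep_save (layers sigma k) A Q0 A0 X Y finset.set0).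
rewrite -[layer_step (layers sigma k)]/(layers sigma k.+1) in R2.
move: R2; case: eqP => [stab|unstab] R2.
  (* By condition (1), the layers cannot be stable at a level from which [C] is avoidable. *)
  by move: iA; rewrite /A (attractor_stable stab prem).
case: m IH km => [|m] IH km.
  case: unstab; have -> : k = #|G| by rewrite -km addn0.
  rewrite -[layers _ _.+1]/(layer_step (fixset layer_step)).
  by rewrite fixsetK //; apply: layer_step_mono.
apply: (@decided_leq ((#|G|.+1 + 1) + m.+2 * (#|G| + 2))); first by nia.
apply: decided_trans (creach_trans R1 R2) _; apply: (IH m) => //.
  by rewrite -km addSnnS.
by exists k.
Qed.

(** With [n = #|G|]: one round for [Setup], [2 * (n + 1)] for the two fixpoints behind condition
    (1), and [(n + 2)^2] for the levels. *)
Lemma checker_decides : exists t (answer : bool) L, [/\ t <= (#|G| + 2) * (#|G| + 4),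
  iter t cstep (gstart checker G reach) = ((reach, Done answer), L) & answer <-> cause].
Proof.
suff [answer [L [[t tt ca] ac]]] :
    decided ((#|G| + 2) * (#|G| + 4)) (gstart checker G reach) by exists t, answer, L.
have R0 := creach_step (cstep_setup (fun=> lab0 checker)).
have R1 := losing_run false finset.set0 finset.set0 [set: G] finset.set0
  finset.set0 finset.set0.
have R2 := premise_run finset.set0 finset.set0 [set: G] finset.set0 X1 finset.set0.
have R := creach_trans (creach_trans R0 R1) R2.
have [iY|iY] := boolP (init G \in fixset (premise_step X1)); rewrite /X1 in iY.
  rewrite iY in R.
  apply: (@decided_leq (1 + #|G|.+1 + #|G|.+1 + #|G|.+2 * (#|G| + 2))); first by nia.
  apply: decided_trans R _; apply: (@attract_decided #|G| 0) => //.
  exact/premise_fixset.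
rewrite (negPf iY) in R; apply: (@decided_leq (1 + #|G|.+1 + #|G|.+1)); first by nia.
apply: decidedI R _; split=> // /cause_premise/premise_fixset.
by rewrite /X1 (negPf iY).
Qed.

End Checker.

Lemma encode_instanceE (x : instance) : encode_instance x =
  graph_word (vertex_header (the_set x)) (vertex_bit (the_strategy x))
    (the_player x == Reach).
Proof. by []. Qed.

Theorem theorem5 (R : realType) :
  decidable_in_ptime encode_instance (is_d_pref_H_cause R).
Proof.
(* There are at most [(n + 3)^2] rounds, setup included, of [5 * size w + 10] steps each. As
   [size w = 2n^2 + 5n + 2], both factors are linearly bounded in [size w], which gives the exponent
   2; 40 absorbs the constants. *)
exists (simulator checker), 40, 2 => x; rewrite encode_instanceE.
have [t [answer [L [tt run_t ac]]]] :=
  checker_decides (the_strategy x) (the_set x) R.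
exists answer; last exact: ac.
have := @simulator_correct checker _ (init (the_game x)) _ _ _ _ _ _ answer run_t erefl.
apply: answers_leq; rewrite /round_cost size_word /row_pos -mulnn; nia.
Qed.
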